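(* In a free group $F(X)$ (with $X$ a finite set), the problem of deciding whether a given equation with $\mathbf{VPL}^{red}$ constraints has a solution satisfying the constraints is undecidable, and hence the problem of deciding whether a given equation with $\mathbf{CF}^\forall$ constraints has a solution satisfying the constraints is also undecidable.
   Context: Notation: for a finite set $X$, $F(X)$ is the free group on $X$, $\Sigma = X\cup X^{-1}$ is the alphabet containing for each $x\in X$ two distinct formal symbols $x,x^{-1}$, and $\pi:\Sigma^\star\to F(X)$ is the monoid homomorphism sending each letter to the corresponding group element. A word over $\Sigma$ is reduced if it contains no factor $aa^{-1}$ with $a\in\Sigma$ (where $(x^{-1})^{-1}=x$). Equations with constraints: let $\mathcal V$ be a finite set of variables. An equation over $F(X)$ is $U=V$ with $U,V$ words over $\Sigma\cup\mathcal V\cup\mathcal V^{-1}$. A solution is a homomorphism $\sigma:F(X\cup\mathcal V)\to F(X)$ fixing $X$ pointwise with $\sigma(U)=\sigma(V)$. Given a set $R_Y\subseteq F(X)$ for each $Y\in\mathcal V$, the solution satisfies the constraints if $\sigma(Y)\in R_Y$ for all $Y\in\mathcal V$. With $\mathbf{VPL}^{red}$ constraints, each $R_Y=\pi(L_Y)$ where $L_Y\subseteq \Sigma^\star$ is a visibly pushdown language consisting of reduced words, given by a visibly pushdown automaton accepting $L_Y$. With $\mathbf{CF}^\forall$ constraints, each $R_Y$ is such that $\pi^{-1}(R_Y)\subseteq\Sigma^\star$ is context-free, given by a pushdown automaton accepting $\pi^{-1}(R_Y)$. Visibly pushdown automaton (VPA): a pushdown automaton (finite set of states, initial state(s), set of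 accepting states, stack alphabet $\Gamma$ with a distinguished bottom-of-stack symbol $\bot\in\Gamma$, initial stack $\bot$) over $\Sigma$ without $\varepsilon$-transitions, for which there is a partition $\Sigma=\Sigma_c\sqcup\Sigma_i\sqcup\Sigma_r$ (calls, internals, responses; parts may be empty) such that: on reading a letter of $\Sigma_i$ the transition neither depends on nor modifies the stack; on reading a letter of $\Sigma_c$ the transition does not depend on the stack and pushes exactly one symbol, different from $\bot$; on reading a letter of $\Sigma_r$ the transition reads the topmost stack symbol and pops it, pushing nothing (if the topmost symbol is $\bot$, it is read but not removed). A word is accepted if the automaton can be in an accepting state after reading it, with no condition on the stack. (Deterministic and nondeterministic VPAs accept the same languages.) A language over $\Sigma$ is a visibly pushdown language if it is accepted by a VPA for some partition of $\Sigma$.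
   Formalization: Proved for every finite set X with at least two elements; when X has at most one element, F(X) is trivial or infinite cyclic and both problems are decidable, so the claim fails there. *)

(* Defs.v *)
From HB Require Import structures.
From mathcomp Require Import all_boot.

Set Implicit Arguments.
Unset Strict Implicit.
Unset Printing Implicit Defensive.

Local Open Scope group_scope.

(* [(x, true)] is the symbol x, [(x, false)] the formal symbol x^-1. *)
Definition letter (X : Type) : Type := (X * bool)%type.

Definition linv (X : Type) (a : letter X) : letter X := (a.1, ~~ a.2).

Section FreeGroup.
Variable X : choiceType.
Implicit Types (a b : letter X) (u v w : seq (letter X)).

Definition reduced w : bool := sorted (fun a b => b != linv a) w.

(* Normal form of a :: w when w is reduced. *)
Definition cons_red a w : seq (letter X) :=
  if w is b :: w' then (if b == linv a then w' else a :: w) else [:: a].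

Definition reduce w : seq (letter X) := foldr cons_red [::] w.

Definition winv w : seq (letter X) := rev [seq linv a | a <- w].

Lemma linvK a : linv (linv a) = a.
Proof. by case: a => x b; rewrite /linv /= negbK. Qed.

Lemma reduced_cons_red a w : reduced w -> reduced (cons_red a w).
Proof.
case: w => [//|b w] /=; case: eqP => [_|/eqP nab] Rw.
  exact: (@path_sorted _ _ b).
by rewrite /= nab.
Qed.

Lemma reduced_foldr u w : reduced w -> reduced (foldr cons_red w u).
Proof. by move=> Rw; elim: u => //= a u; apply: reduced_cons_red. Qed.

Lemma reduce_reduced w : reduced (reduce w).
Proof. exact: reduced_foldr. Qed.

Lemma reduce_id w : reduced w -> reduce w = w.
Proof.
elim: w => //= a w IHw Raw; rewrite /reduce /= -/(reduce w) IHw.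
  by case: w Raw {IHw} => //= b w /andP[/negbTE-> _].
exact: (@path_sorted _ _ a).
Qed.

Lemma cons_redK a w : reduced w -> cons_red (linv a) (cons_red a w) = w.
Proof.
case: w => [|b w] /= Rw; first by rewrite linvK eqxx.
case: (eqVneq b (linv a)) Rw => [-> | _ _] /=; last by rewrite linvK eqxx.
by case: w => //= c w /andP[/negbTE-> _].
Qed.

Lemma foldr_reduce u w :
  reduced w -> foldr cons_red w (reduce u) = foldr cons_red w u.
Proof.
move=> Rw; elim: u => //= a u <-; case: (reduce u) => //= b v.
case: eqP => //= ->; rewrite -{1}[a]linvK cons_redK //.
exact: reduced_foldr.
Qed.

Lemma foldr_winvK u w :
  reduced w -> foldr cons_red (foldr cons_red w u) (winv u) = w.
Proof.
move=> Rw; elim: u => //= a u IHu.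
rewrite /winv /= rev_cons foldr_rcons cons_redK //.
exact: reduced_foldr.
Qed.

Lemma winvK : involutive winv.
Proof. by move=> w; rewrite /winv map_rev revK mapK //; apply: linvK. Qed.

Lemma reduced_winv w : reduced w -> reduced (winv w).
Proof.
rewrite /reduced /winv rev_sorted sorted_map; congr (is_true _).
apply: eq_sorted => a b /=.
by rewrite linvK eq_sym; apply/idP/idP => /eqP n; apply/eqP => e; apply: n;
  rewrite -?e ?linvK // e ?linvK.
Qed.

Record free_group := FreeGroup {fg_word :> seq (letter X); _ : reduced fg_word}.

HB.instance Definition _ := [isSub for fg_word].
HB.instance Definition _ := [Choice of free_group by <:].

Definition fg_one : free_group := @FreeGroup [::] isT.
Definition fg_mul (g h : free_group) : free_group :=
  FreeGroup (reduce_reduced (g ++ h)).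
Definition fg_inv (g : free_group) : free_group :=
  FreeGroup (reduced_winv (valP g)).

Lemma fg_mulA : associative fg_mul.
Proof.
have red_cat u v : reduce (u ++ v) = foldr cons_red (reduce v) u.
  by rewrite /reduce foldr_cat.
move=> g h k; apply: val_inj; rewrite /= [LHS]red_cat [RHS]red_cat.
rewrite red_cat [RHS]foldr_reduce ?reduce_reduced // foldr_cat; congr (foldr _ _ _).
by rewrite reduce_id // reduced_foldr // reduce_reduced.
Qed.

Lemma fg_mul1 : left_id fg_one fg_mul.
Proof. by move=> g; apply: val_inj; rewrite /= reduce_id ?(valP g). Qed.

Lemma fg_mulr1 : right_id fg_one fg_mul.
Proof. by move=> g; apply: val_inj; rewrite /= cats0 reduce_id ?(valP g). Qed.

Lemma fg_mulV : left_inverse fg_one fg_inv fg_mul.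
Proof.
by move=> g; apply: val_inj; rewrite /= /reduce foldr_cat foldr_winvK.
Qed.

Lemma fg_mulrV : right_inverse fg_one fg_inv fg_mul.
Proof.
move=> g; apply: val_inj; rewrite /= /reduce foldr_cat.
by have := @foldr_winvK (winv g) [::] isT; rewrite winvK.
Qed.

HB.instance Definition _ :=
  isGroup.Build free_group fg_mulA fg_mul1 fg_mulr1 fg_mulV fg_mulrV.

Definition fg_letter a : free_group := @FreeGroup [:: a] isT.

Definition fg_gen (x : X) : free_group := fg_letter (x, true).

Lemma fg_letterV a : fg_letter (linv a) = (fg_letter a)^-1.
Proof. exact: val_inj. Qed.

(* The canonical monoid homomorphism pi from words to F(X). *)
Definition fg_proj w : free_group := \prod_(a <- w) fg_letter a.

Lemma fg_projE w : fg_word (fg_proj w) = reduce w.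
Proof.
rewrite /fg_proj; elim: w => [|a w IHw]; first by rewrite big_nil.
by rewrite big_cons /= IHw {1}/reduce /= -/(reduce _) reduce_id ?reduce_reduced.
Qed.

End FreeGroup.

Section Automata.
Variable X : finType.

Inductive vpa_kind := Call | Internal | Response.

(* The stack alphabet consists of ['I_vpa_nstack] and of a bottom symbol. The
   bottom symbol is never pushed nor removed, so it is left out of the stack:
   the list [s] stands for s followed by the bottom symbol, whose topmost symbol
   is [ohead s] ([None] being the bottom) and which [behead] pops.  A transition
   listed for a letter of the wrong kind is never taken. *)
Record vpa := Vpa {
  vpa_nstate : nat;
  vpa_nstack : nat;
  vpa_part : {ffun letter X -> vpa_kind};
  vpa_init : seq 'I_vpa_nstate;
  vpa_final : seq 'I_vpa_nstate;
  vpa_call : seq ('I_vpa_nstate * letter X * 'I_vpa_nstate * 'I_vpa_nstack);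
  vpa_internal : seq ('I_vpa_nstate * letter X * 'I_vpa_nstate);
  vpa_response :
    seq ('I_vpa_nstate * letter X * option 'I_vpa_nstack * 'I_vpa_nstate)
}.

Definition vpa_step (A : vpa) (q : 'I_(vpa_nstate A)) (s : seq 'I_(vpa_nstack A))
    (a : letter X) (q' : 'I_(vpa_nstate A)) (s' : seq 'I_(vpa_nstack A)) : Prop :=
  match vpa_part A a with
  | Call => exists2 c, (q, a, q', c) \in vpa_call A & s' = c :: s
  | Internal => (q, a, q') \in vpa_internal A /\ s' = s
  | Response => (q, a, ohead s, q') \in vpa_response A /\ s' = behead s
  end.

Fixpoint vpa_run (A : vpa) (q : 'I_(vpa_nstate A)) (s : seq 'I_(vpa_nstack A))
    (w : seq (letter X)) : Prop :=
  if w is a :: w' then exists q' s', vpa_step q s a q' s' /\ vpa_run q' s' w'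
  else q \in vpa_final A.

Definition vpa_accepts (A : vpa) (w : seq (letter X)) : Prop :=
  exists2 q, q \in vpa_init A & vpa_run q [::] w.

(* [(q, o, c, q', r)] in [pda_trans]: in state q, reading o ([None] for an
   epsilon-transition) with c on top of the stack, go to q' and replace c by r. *)
Record pda := Pda {
  pda_nstate : nat;
  pda_nstack : nat;
  pda_bottom : 'I_pda_nstack;
  pda_init : seq 'I_pda_nstate;
  pda_final : seq 'I_pda_nstate;
  pda_trans : seq ('I_pda_nstate * option (letter X) * 'I_pda_nstack *
                   'I_pda_nstate * seq 'I_pda_nstack)
}.

Inductive pda_run (P : pda) :
    'I_(pda_nstate P) -> seq 'I_(pda_nstack P) -> seq (letter X) -> Prop :=
| PdaStop q s : q \in pda_final P -> pda_run q s [::]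
| PdaStep q o c q' r s w :
    (q, o, c, q', r) \in pda_trans P -> pda_run q' (r ++ s) w ->
    pda_run q (c :: s) (if o is Some a then a :: w else w).

Definition pda_accepts (P : pda) (w : seq (letter X)) : Prop :=
  exists2 q, q \in pda_init P & pda_run q [:: pda_bottom P] w.

End Automata.

(* The variables are ['I_eqn_nvar]; [C] is the type of the data presenting the
   constraint sets. *)
Record equation (X : finType) (C : Type) := Equation {
  eqn_nvar : nat;
  eqn_lhs : seq (letter (X + 'I_eqn_nvar));
  eqn_rhs : seq (letter (X + 'I_eqn_nvar));
  eqn_constr : eqn_nvar.-tuple C
}.

Section Equations.
Variables (X : finType) (C : Type).

(* [presents c R]: the datum [c] is a valid description of the set R. *)
Variable presents : C -> (free_group X -> Prop) -> Prop.

Definition is_solution (E : equation X C)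
    (sigma : {multiplicative free_group (X + 'I_(eqn_nvar E))%type ->
                             free_group X}) : Prop :=
  (forall x : X, sigma (fg_gen (inl x)) = fg_gen x) /\
  sigma (fg_proj (eqn_lhs E)) = sigma (fg_proj (eqn_rhs E)).

Definition constraints_of (E : equation X C)
    (R : 'I_(eqn_nvar E) -> free_group X -> Prop) : Prop :=
  forall Y, presents (tnth (eqn_constr E) Y) (R Y).

Definition valid_instance (E : equation X C) : Prop :=
  exists R, @constraints_of E R.

Definition solvable (E : equation X C) : Prop :=
  exists2 R, @constraints_of E R &
  exists2 sigma, @is_solution E sigma &
  forall Y, R Y (sigma (fg_gen (inr Y))).

End Equations.

Section Constraints.
Variable X : finType.

Definition vpl_red (A : vpa X) (R : free_group X -> Prop) : Prop :=
  (forall w, vpa_accepts A w -> reduced w) /\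
  (forall g, R g <-> exists2 w, vpa_accepts A w & fg_proj w = g).

Definition cf_forall (P : pda X) (R : free_group X -> Prop) : Prop :=
  forall w, pda_accepts P w <-> R (fg_proj w).

End Constraints.

Definition bits := seq bool.

Definition enc_nat (n : nat) : bits := nseq n true ++ [:: false].

Definition enc_seq (T : Type) (e : T -> bits) (s : seq T) : bits :=
  flatten [seq true :: e x | x <- s] ++ [:: false].

Definition enc_option (T : Type) (e : T -> bits) (o : option T) : bits :=
  if o is Some x then true :: e x else [:: false].

Definition enc_ord (n : nat) (i : 'I_n) : bits := enc_nat i.

Definition enc_letter (X : finType) (a : letter X) : bits :=
  enc_ord (enum_rank a.1) ++ [:: a.2].

Definition enc_eq_letter (X : finType) (n : nat) (a : letter (X + 'I_n)) : bits :=
  match a.1 with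
  | inl x => false :: enc_ord (enum_rank x)
  | inr Y => true :: enc_ord Y
  end ++ [:: a.2].

Definition enc_kind (k : vpa_kind) : bits :=
  enc_nat match k with Call => 0 | Internal => 1 | Response => 2 end.

Definition enc_vpa (X : finType) (A : vpa X) : bits :=
  enc_nat (vpa_nstate A) ++ enc_nat (vpa_nstack A) ++
  flatten [seq enc_kind (vpa_part A a) | a <- enum {: letter X}] ++
  enc_seq (@enc_ord _) (vpa_init A) ++ enc_seq (@enc_ord _) (vpa_final A) ++
  enc_seq (fun '(q, a, q', c) =>
             enc_ord q ++ enc_letter a ++ enc_ord q' ++ enc_ord c)
          (vpa_call A) ++
  enc_seq (fun '(q, a, q') => enc_ord q ++ enc_letter a ++ enc_ord q')
          (vpa_internal A) ++
  enc_seq (fun '(q, a, t, q') =>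
             enc_ord q ++ enc_letter a ++ enc_option (@enc_ord _) t ++ enc_ord q')
          (vpa_response A).

Definition enc_pda (X : finType) (P : pda X) : bits :=
  enc_nat (pda_nstate P) ++ enc_nat (pda_nstack P) ++ enc_ord (pda_bottom P) ++
  enc_seq (@enc_ord _) (pda_init P) ++ enc_seq (@enc_ord _) (pda_final P) ++
  enc_seq (fun '(q, o, c, q', r) =>
             enc_ord q ++ enc_option (@enc_letter X) o ++ enc_ord c ++
             enc_ord q' ++ enc_seq (@enc_ord _) r)
          (pda_trans P).

Definition enc_equation (X : finType) (C : Type) (e : C -> bits)
    (E : equation X C) : bits :=
  enc_nat (eqn_nvar E) ++
  enc_seq (@enc_eq_letter X _) (eqn_lhs E) ++
  enc_seq (@enc_eq_letter X _) (eqn_rhs E) ++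
  enc_seq e (eqn_constr E).

(* These encodings are prefix-free, so that a sequence of items may be encoded by
   concatenation, and in particular they are injective. *)
Definition prefix_free (T : Type) (e : T -> bits) : Prop :=
  forall x y s t, e x ++ s = e y ++ t -> x = y /\ s = t.


Lemma prefix_free_cat (T : Type) (e : T -> bits) x y u v s t :
  prefix_free e -> (e x ++ u) ++ s = (e y ++ v) ++ t -> x = y /\ u ++ s = v ++ t.
Proof. by rewrite -!catA => eP /eP. Qed.

Lemma enc_nat_free : prefix_free enc_nat.
Proof.
by rewrite /enc_nat; elim=> [|m IHm] [|n] s t //= [] // /IHm[[->] ->].
Qed.
Local Opaque enc_nat.

Lemma enc_seq_free (T : Type) (e : T -> bits) :
  prefix_free e -> prefix_free (enc_seq e).
Proof.
move=> eP; rewrite /enc_seq; elim=> [|x u IHu] [|y v] s t //=; first by case.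
by case; rewrite -!catA => /eP[->]; rewrite !catA => /IHu[-> ->].
Qed.
Local Opaque enc_seq.

Lemma enc_option_free (T : Type) (e : T -> bits) :
  prefix_free e -> prefix_free (enc_option e).
Proof. by move=> eP [x|] [y|] s t //= [] // /eP[-> ->]. Qed.
Local Opaque enc_option.

Lemma enc_ord_free n : prefix_free (@enc_ord n).
Proof. by move=> i j s t /enc_nat_free[/val_inj-> ->]. Qed.
Local Opaque enc_ord.

Lemma enc_letter_free (X : finType) : prefix_free (@enc_letter X).
Proof.
move=> [x b] [y c] s t; rewrite /enc_letter.
by move=> /(prefix_free_cat (@enc_ord_free _))[/enum_rank_inj/=-> [-> ->]].
Qed.
Local Opaque enc_letter.

Lemma enc_eq_letter_free (X : finType) n : prefix_free (@enc_eq_letter X n).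
Proof.
move=> [[x|x] b] [[y|y] c] s t; rewrite /enc_eq_letter //=.
  by case=> /(prefix_free_cat (@enc_ord_free _))[/enum_rank_inj/=-> [-> ->]].
by case=> /(prefix_free_cat (@enc_ord_free _))[-> [-> ->]].
Qed.
Local Opaque enc_eq_letter.

Lemma enc_kind_free : prefix_free enc_kind.
Proof. by move=> [] [] s t /enc_nat_free[]. Qed.
Local Opaque enc_kind.

Lemma enc_fun_free (I : eqType) (T : Type) (e : T -> bits) (f g : I -> T)
    (r : seq I) s t : prefix_free e ->
  flatten [seq e (f i) | i <- r] ++ s = flatten [seq e (g i) | i <- r] ++ t ->
  {in r, f =1 g} /\ s = t.
Proof.
move=> eP; elim: r => //= i r IHr; rewrite -!catA => /eP[fgi /IHr[fg ->]].
by split=> // j /[!inE] /predU1P[->|/fg].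
Qed.

Lemma enc_vpa_free (X : finType) : prefix_free (@enc_vpa X).
Proof.
have ordP n := @enc_ord_free n; have letP := @enc_letter_free X.
have seqP n := enc_seq_free (ordP n).
move=> [n g p i f c l r] [n' g' p' i' f' c' l' r'] s t; rewrite /enc_vpa /=.
move=> /(prefix_free_cat enc_nat_free)[En].
case: n' / En i' f' c' l' r' => i' f' c' l' r'.
move=> /(prefix_free_cat enc_nat_free)[Eg]; case: g' / Eg c' r' => c' r'.
rewrite -catA -[X in _ = X -> _]catA.
move=> /(enc_fun_free enc_kind_free)[Ep].
have{Ep}-> : p = p' by apply/ffunP=> a; rewrite Ep ?mem_enum.
move=> /(prefix_free_cat (seqP _))[->] /(prefix_free_cat (seqP _))[->].
rewrite -catA -[X in _ = X -> _]catA => /enc_seq_free[|->].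
  move=> [[[q a] q'] d] [[[u b] u'] e] x y /=.
  by move=> /(prefix_free_cat (ordP _))[->] /(prefix_free_cat letP)[->]
            /(prefix_free_cat (ordP _))[->] /ordP[-> ->].
rewrite -catA -[X in _ = X -> _]catA => /enc_seq_free[|->].
  move=> [[q a] q'] [[u b] u'] x y /=.
  by move=> /(prefix_free_cat (ordP _))[->] /(prefix_free_cat letP)[->]
            /ordP[-> ->].
case/enc_seq_free=> [|-> ->] //.
move=> [[[q a] d] q'] [[[u b] e] u'] x y /=.
by move=> /(prefix_free_cat (ordP _))[->] /(prefix_free_cat letP)[->]
          /(prefix_free_cat (enc_option_free (ordP _)))[->] /ordP[-> ->].
Qed.

Lemma enc_pda_free (X : finType) : prefix_free (@enc_pda X).
Proof.
have ordP n := @enc_ord_free n; have seqP n := enc_seq_free (ordP n).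
have optP := enc_option_free (@enc_letter_free X).
move=> [n g z i f r] [n' g' z' i' f' r'] s t; rewrite /enc_pda /=.
move=> /(prefix_free_cat enc_nat_free)[En]; case: n' / En i' f' r' => i' f' r'.
move=> /(prefix_free_cat enc_nat_free)[Eg]; case: g' / Eg z' r' => z' r'.
move=> /(prefix_free_cat (ordP _))[->].
move=> /(prefix_free_cat (seqP _))[->] /(prefix_free_cat (seqP _))[->].
case/enc_seq_free=> [|-> ->] //.
move=> [[[[q o] c] q'] v] [[[[u a] d] u'] v'] x y /=.
by move=> /(prefix_free_cat (ordP _))[->] /(prefix_free_cat optP)[->]
          /(prefix_free_cat (ordP _))[->] /(prefix_free_cat (ordP _))[->]
          /seqP[-> ->].
Qed.

Lemma enc_equation_free (X : finType) (C : Type) (e : C -> bits) :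
  prefix_free e -> prefix_free (@enc_equation X C e).
Proof.
move=> eP [n u v c] [n' u' v' c'] s t; rewrite /enc_equation /=.
move=> /(prefix_free_cat enc_nat_free)[En]; case: n' / En u' v' c' => u' v' c'.
have letP := enc_seq_free (@enc_eq_letter_free X n).
move=> /(prefix_free_cat letP)[->] /(prefix_free_cat letP)[->].
by move=> /(enc_seq_free eP)[/val_inj-> ->].
Qed.

Inductive tm_move := MoveLeft | MoveStay | MoveRight.

(* Deterministic machines with one two-way infinite tape. A cell is blank
   ([None]), or contains a bit or an auxiliary symbol. [tm_delta] either halts
   with an answer or gives the next state, the symbol written and the move. *)
Definition tm_cell (T : Type) : Type := option (bool + T).

Record tm := Tm {
  tm_state : finType;
  tm_aux : finType;
  tm_start : tm_state;
  tm_delta : tm_state -> tm_cell tm_aux ->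
             bool + (tm_state * tm_cell tm_aux * tm_move)
}.

(* Cells to the left of the head (nearest first), scanned cell, cells to the
   right of the head; all the other cells are blank. *)
Definition tape (T : Type) : Type :=
  (seq (tm_cell T) * tm_cell T * seq (tm_cell T))%type.

Definition tape_move (T : Type) (m : tm_move) (t : tape T) : tape T :=
  let: (l, c, r) := t in
  match m with
  | MoveLeft => (behead l, head None l, c :: r)
  | MoveStay => t
  | MoveRight => (c :: l, head None r, behead r)
  end.

Definition tape_init (T : Type) (w : bits) : tape T :=
  let cells := [seq Some (inl b) | b <- w] in
  ([::], head None cells, behead cells).

(* The answer of [M], if it halts within [n] steps from state [q] and tape [t]. *)
Fixpoint tm_run (M : tm) (n : nat) (q : tm_state M) (t : tape (tm_aux M)) :
    option bool :=
  if n is n'.+1 then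
    let: (l, c, r) := t in
    match tm_delta q c with
    | inl b => Some b
    | inr (q', c', m) => tm_run n' q' (tape_move m (l, c', r))
    end
  else None.

Definition tm_answers (M : tm) (w : bits) (b : bool) : Prop :=
  exists n, tm_run n (tm_start M) (tape_init (tm_aux M) w) = Some b.

(* Decidability by a Turing machine of the problem [yes] on the inputs satisfying
   [valid]; nothing is required of the machine, not even termination, on other
   inputs. *)
Definition tm_decidable (I : Type) (enc : I -> bits) (valid yes : I -> Prop) :
    Prop :=
  exists M : tm, forall i : I, valid i ->
    (yes i -> tm_answers M (enc i) true) /\
    (~ yes i -> tm_answers M (enc i) false).

(* Main.v *)
From HB Require Import structures.
Require Import Defs.
From mathcomp Require Import all_boot.
From Stdlib Require Import Relation_Operators Operators_Properties.

(* Let x, y be two generators. Configurations of a rewriting system are coded by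
   words u over x and y, and mirrored configurations by words over x^-1 and y^-1.
   A visibly pushdown automaton whose calls are the positive letters accepts the
   words u_0 v_0' u_1 v_1' .. u_k, where v_i' mirrors a word obtained from u_i by
   one rewriting step and u_k contains a final symbol. With the negative letters
   as calls, another one checks that v_i = u_(i+1). The coding makes these words
   reduced, so the equation Y = u Z with these two constraints on Y and Z is
   solvable if and only if a final symbol can be reached from u followed by
   sufficiently many spaces.

   If a machine M decided solvability, let the rules of the rewriting system make
   it turn the bits w found in u into A B(w) w and then run M on this word, the
   final symbol being produced when M answers no. These rules, and hence the two
   automata, depend on A, B and M only. The encoding of the equation is A B(w) t,
   where A and B are fixed and t encodes the end of the equation and the two
   automata, so that with w = t the equation is solvable if and only if M answers
   no on it.

   For context-free preimages, a pushdown automaton simulates a visibly pushdown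
   one on the free reduction of its input. *)

Set Implicit Arguments.
Unset Strict Implicit.
Unset Printing Implicit Defensive.

(** * Rewriting systems and machines with two stacks *)

Local Notation steps := (clos_refl_trans _).

Section Rewriting.
Variable G : eqType.
Implicit Types (u v p l r s : seq G) (rules : seq (seq G * seq G)).

Definition rewrites rules u v : Prop :=
  exists p l r s, [/\ (l, r) \in rules, u = p ++ l ++ s & v = p ++ r ++ s].

Lemma rewrites_catl rules p u v :
  steps (rewrites rules) u v -> steps (rewrites rules) (p ++ u) (p ++ v).
Proof.
elim=> {u v} [u v [q [l [r [s [lr -> ->]]]]]|u|u v w _ + _]; last exact: rt_trans.
  by apply: rt_step; exists (p ++ q), l, r, s; rewrite -!catA.
exact: rt_refl.
Qed.

Lemma rewrites_catr rules s u v :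
  steps (rewrites rules) u v -> steps (rewrites rules) (u ++ s) (v ++ s).
Proof.
elim=> {u v} [u v [p [l [r [t [lr -> ->]]]]]|u|u v w _ + _]; last exact: rt_trans.
  by apply: rt_step; exists p, l, r, (t ++ s); rewrite -!catA.
exact: rt_refl.
Qed.

End Rewriting.

(* A configuration [(L, h, R)] stands for the word [rev L ++ h :: R]: the head
   sees the top symbols of the two stacks L and R, and replaces them. *)
Section TwoStacks.
Variables (S H : finType).
Variable delta : H -> S -> S -> option (seq S * H * seq S).

Definition config : Type := seq S * H * seq S.

(** [catrev] puts the last letter of [x] on top of the left stack, so that the rewritten part of the
    word reads [x], [h'], [y]. *)
Definition tstep (c : config) : option config :=
  let: (L, h, R) := c in
  if L is a :: L' then
    if R is b :: R' then
      if delta h a b is Some (x, h', y) then Some (catrev x L', h', y ++ R')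
      else None
    else None
  else None.

Definition tnext (c c' : config) : Prop := tstep c = Some c'.

Definition config_word (c : config) : seq (S + H) :=
  let: (L, h, R) := c in map inl (rev L) ++ inr h :: map inl R.

Definition trule (t : S * H * S) : option (seq (S + H) * seq (S + H)) :=
  let: (a, h, b) := t in
  if delta h a b is Some (x, h', y) then
    Some ([:: inl a; inr h; inl b], map inl x ++ inr h' :: map inl y)
  else None.

Definition trules : seq (seq (S + H) * seq (S + H)) :=
  pmap trule (enum {: S * H * S}).

Lemma mem_trules l r :
  reflect (exists t, trule t = Some (l, r)) ((l, r) \in trules).
Proof.
rewrite mem_pmap; apply: (iffP mapP) => [[t _ ->]|[t Et]]; first by exists t.
by exists t; rewrite ?mem_enum.
Qed.

Lemma head_uniq (x y x' y' : seq (S + H)) h h' (u : seq S) :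
    x = map inl u -> (forall k, inr k \notin y) ->
    x ++ inr h :: y = x' ++ inr h' :: y' ->
  [/\ x = x', h = h' & y = y'].
Proof.
move=> + ny; elim: u x x' => [|a u IHu] x x' -> /=.
  case: x' => [[-> ->] //|b x' [_ Ey]].
  by move: (ny h'); rewrite Ey mem_cat inE eqxx orbT.
case: x' => [//|b x' [<- /IHu]].
by case=> // -> -> ->.
Qed.

(** Left-hand sides and configuration words contain one head symbol each, so by [head_uniq] a rule
    can only apply around the head. *)
Lemma rewrites_config c v :
  rewrites trules (config_word c) v <-> exists2 c', tnext c c' & v = config_word c'.
Proof.
case: c => [[L h] R]; rewrite /tnext; split.
  case=> p [l [r [s [/mem_trules[[[a k] b]] /=]]]].
  case Ed: delta => [[[x h'] y]|//] [<- <-].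
  rewrite (_ : p ++ _ ++ s = (p ++ [:: inl a]) ++ inr k :: inl b :: s);
    last by rewrite -catA.
  move=> /(head_uniq (erefl _))[|EL Eh ER ->].
    by move=> ? ; apply/mapP=> -[].
  rewrite -{}Eh in Ed.
  case: R ER => [//|b0 R] /= [Eb <-]; rewrite -{}Eb in Ed; case: L EL => [|a0 L] /=.
    by case: p.
  rewrite rev_cons map_rcons -cats1 => /(congr1 rev).
  rewrite !rev_cat /= => -[Ea /(can_inj revK) <-]; rewrite -{}Ea in Ed.
  rewrite Ed; eexists; first by [].
  by rewrite /= catrevE rev_cat revK !map_cat -!catA.
case=> -[[L' h'] R']; case: L => [//|a L] /=; case: R => [//|b R] /=.
case Ed: delta => [[[x k] y]|//] [<- <- <-] ->.
exists (map inl (rev L)), [:: inl a; inr h; inl b],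
  (map inl x ++ inr k :: map inl y), (map inl R); split.
- by apply/mem_trules; exists (a, h, b); rewrite /= Ed.
- by rewrite rev_cons map_rcons -cats1 -catA.
- by rewrite catrevE rev_cat revK !map_cat -!catA.
Qed.

Lemma steps_config c v :
  steps (rewrites trules) (config_word c) v <->
  exists2 c', steps tnext c c' & v = config_word c'.
Proof.
split=> [|[c' st ->]].
  move Eu: (config_word c) => u st.
  elim: {st}(clos_rt_rt1n _ _ _ _ st) c Eu => {u v} [u|u v w + _ IHw] c Eu.
    by exists c; [exact: rt_refl | rewrite Eu].
  rewrite -Eu => /rewrites_config[c' cc' /esym/IHw[c'' c'c'' ->]].
  by exists c'' => //; apply: rt_trans c'c''; apply: rt_step.
elim: st => {c c'} [c c' cc'|c|c1 c2 c3 _ + _]; last exact: rt_trans.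
  by apply/rt_step/rewrites_config; exists c'.
exact: rt_refl.
Qed.

Definition reaches (f : H) (c : config) : Prop :=
  exists2 c' : config, steps tnext c c' & c'.1.2 = f.

Lemma reaches_config f c :
  reaches f c <->
  exists2 v, steps (rewrites trules) (config_word c) v & inr f \in v.
Proof.
split=> [[c' st Ef]|[v /steps_config[[[L h] R] st ->]]].
  exists (config_word c'); first by apply/steps_config; exists c'.
  by case: c' Ef {st} => [[L h] R] /= ->; rewrite mem_cat inE eqxx orbT.
rewrite /= mem_cat inE => /or3P[/mapP[]//|/eqP[->]|/mapP[]//].
by exists (L, h, R).
Qed.

(** [tstep] is a function, so a nonempty run from [c] begins with the step to [c']; an empty one
    would put [c] in state [f], which no step leaves. *)
Lemma reaches_next f c c' :
  (forall a b, delta f a b = None) -> tnext c c' -> reaches f c <-> reaches f c'.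
Proof.
move=> fN cc'; split=> [[d st Ef]|[d st Ef]]; last first.
  by exists d => //; apply: rt_trans st; apply: rt_step.
case: {st}(clos_rt_rt1n _ _ _ _ st) Ef => [Ef|e d' ce ed Ef].
- case: c cc' Ef => [[L h] R] + /= Ef; rewrite /tnext /= Ef.
  by case: L => [|a L] //=; case: R => [|b R] //=; rewrite fN.
- move: ce; rewrite /tnext cc' => -[->]; exists d' => //.
  exact: clos_rt1n_rt.
Qed.

Lemma reaches_steps f c c' :
  (forall a b, delta f a b = None) -> steps tnext c c' ->
  reaches f c <-> reaches f c'.
Proof.
move=> fN; elim=> {c c'} [c c'|c|c1 c2 c3 _ IH1 _ IH2] //.
  exact: reaches_next.
by split=> [/IH1/IH2|/IH2/IH1].
Qed.

Lemma walk_right h g x a L R :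
    (forall a b, b \in x -> delta h a b = Some ([:: a; g b], h, [::])) ->
  steps tnext (a :: L, h, x ++ R) (catrev (map g x) (a :: L), h, R).
Proof.
elim: x a L => [|b x IHx] a L dh; first exact: rt_refl.
apply: rt_trans (IHx (g b) (a :: L) _); last first.
  by move=> *; apply: dh; rewrite inE orbC; apply/orP; left.
by apply: rt_step; rewrite /tnext /= dh ?mem_head.
Qed.

Lemma walk_left h x L b R :
    (forall a b, a \in x -> delta h a b = Some ([::], h, [:: a; b])) ->
  steps tnext (x ++ L, h, b :: R) (L, h, catrev x (b :: R)).
Proof.
elim: x b R => [|a x IHx] b R dh; first exact: rt_refl.
apply: rt_trans (IHx a (b :: R) _); last first.
  by move=> *; apply: dh; rewrite inE orbC; apply/orP; left.
by apply: rt_step; rewrite /tnext /= dh ?mem_head.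
Qed.

End TwoStacks.

(** * Simulation of Turing machines *)

(** [Raw] bits are not yet on the simulated tape, and [Sep] separates those still to be read from
    those already copied. The end markers are never removed, which keeps both stacks nonempty. *)
Inductive symbol (T : Type) :=
  Cell of tm_cell T | Raw of bool | Sep | LeftEnd | RightEnd.
Arguments Raw {T} b.
Arguments Sep {T}.
Arguments LeftEnd {T}.
Arguments RightEnd {T}.

Definition symbol_code T (a : symbol T) : tm_cell T + (bool + option bool) :=
  match a with
  | Cell c => inl c
  | Raw b => inr (inl b)
  | Sep => inr (inr None)
  | LeftEnd => inr (inr (Some false))
  | RightEnd => inr (inr (Some true))
  end.

Definition symbol_decode T (c : tm_cell T + (bool + option bool)) : symbol T :=
  match c with
  | inl c => Cell c
  | inr (inl b) => Raw b
  | inr (inr None) => Sep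
  | inr (inr (Some false)) => LeftEnd
  | inr (inr (Some true)) => RightEnd
  end.

Lemma symbol_codeK T : cancel (@symbol_code T) (@symbol_decode T).
Proof. by case. Qed.

HB.instance Definition _ (T : finType) :=
  Countable.copy (symbol T) (can_type (@symbol_codeK T)).
HB.instance Definition _ (T : finType) :=
  isFinite.Build (symbol T) (pcan_enumP (can_pcan (@symbol_codeK T))).

(** In a loop, [Read] replaces the next raw bit by its expansion, [Carry] brings the bit to the
    right end and [Back] returns. After [Sep], [Convert] turns the copied bits into cells, and
    [Rewind] goes to the left end, where M starts. [Accept] means that M answered no. *)
Inductive phase := Read | Carry of bool | Back | Convert | Rewind | Accept.

Definition phase_code (p : phase) : bool + option (option bool) + bool :=
  match p with
  | Carry b => inr b
  | Read => inl (inl false)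
  | Back => inl (inl true)
  | Convert => inl (inr None)
  | Rewind => inl (inr (Some None))
  | Accept => inl (inr (Some (Some true)))
  end.

Definition phase_decode (c : bool + option (option bool) + bool) : phase :=
  match c with
  | inr b => Carry b
  | inl (inl false) => Read
  | inl (inl true) => Back
  | inl (inr None) => Convert
  | inl (inr (Some None)) => Rewind
  | inl (inr (Some (Some _))) => Accept
  end.

Lemma phase_codeK : cancel phase_code phase_decode.
Proof. by case. Qed.

HB.instance Definition _ := Countable.copy phase (can_type phase_codeK).
HB.instance Definition _ :=
  isFinite.Build phase (pcan_enumP (can_pcan phase_codeK)).

Section Simulation.
Variables (M : tm) (pre : bits) (expand : bool -> bits).

Notation sym := (symbol (tm_aux M)).
Notation head := (tm_state M + phase)%type.

Definition bit_cell (b : bool) : sym := Cell (Some (inl b)).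

Definition delta (h : head) (a b : sym) : option (seq sym * head * seq sym) :=
  match h, a, b with
  | inr Read, _, Raw c =>
      Some (a :: map bit_cell (expand c), inr (Carry c), [::])
  | inr Read, _, Sep => Some ([:: a], inr Convert, [::])
  | inr (Carry c), _, RightEnd => Some ([:: a], inr Back, [:: Raw c; b])
  | inr (Carry c), _, _ => Some ([:: a; b], h, [::])
  | inr Back, (Raw _ | Sep), _ => Some ([::], h, [:: a; b])
  | inr Back, _, _ => Some ([:: a], inr Read, [:: b])
  | inr Convert, _, Raw c => Some ([:: a; bit_cell c], h, [::])
  | inr Convert, _, RightEnd => Some ([:: a], inr Rewind, [:: b])
  | inr Rewind, LeftEnd, _ =>
      Some ([:: a], inl (tm_start M), rcons (map bit_cell pre) b)
  | inr Rewind, _, _ => Some ([::], h, [:: a; b])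
  | inl q, _, Cell c =>
      match tm_delta q c with
      | inl true => None
      | inl false => Some ([:: a], inr Accept, [:: b])
      | inr (q', c', MoveStay) => Some ([:: a], inl q', [:: Cell c'])
      | inr (q', c', MoveRight) => Some ([:: a; Cell c'], inl q', [::])
      | inr (q', c', MoveLeft) =>
          if a is Cell _ then Some ([::], inl q', [:: a; Cell c'])
          else Some ([:: a], inl q', [:: Cell None; Cell c'])
      end
  | inl _, _, RightEnd => Some ([:: a], h, [:: Cell None; b])
  | _, _, _ => None
  end.

(** [r] begins with the scanned cell; when [r] is empty, this cell is a blank one not yet
    written. *)
Definition tape_config (l : seq (tm_cell (tm_aux M))) (q : tm_state M)
    (r : seq (tm_cell (tm_aux M))) : config sym head :=
  (rcons (map (@Cell _) l) LeftEnd, inl q, rcons (map (@Cell _) r) RightEnd).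

Notation accepts := (reaches delta (inr Accept)).

Lemma accepts_next c c' : tnext delta c c' -> accepts c <-> accepts c'.
Proof. by apply: reaches_next => -[]. Qed.

Lemma tape_config_next l q r :
  tstep delta (tape_config l q r) =
  match r with
  | [::] => Some (tape_config l q [:: None])
  | c :: r' =>
      match tm_delta q c with
      | inl true => None
      | inl false => Some (rcons (map (@Cell _) l) LeftEnd, inr Accept,
                           rcons (map (@Cell _) r) RightEnd)
      | inr (q', c', MoveLeft) =>
          Some (tape_config (behead l) q' (seq.head None l :: c' :: r'))
      | inr (q', c', MoveStay) => Some (tape_config l q' (c' :: r'))
      | inr (q', c', MoveRight) => Some (tape_config (c' :: l) q' r')
      end
  end.
Proof.
case: l => [|c' l]; case: r => [|c r] //=.
all: by case: tm_delta => [[]|[[q' d] []]].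
Qed.

Lemma accepts_run n l q r :
  tm_run n q (l, seq.head None r, behead r) = Some false ->
  accepts (tape_config l q r).
Proof.
elim: n l q r => //= n IHn l q r Hr.
(* Writing a blank cell before the right marker changes neither [seq.head None r] nor [behead r]. *)
wlog [c [r' Er]] : r Hr / exists c r', r = c :: r'.
  move=> W; case: r Hr => [|c r] Hr; last by apply: W => //; exists c, r.
  apply/(@accepts_next _ (tape_config l q [:: None])); last apply: W => //.
    by rewrite /tnext tape_config_next.
  by exists None, [::].
move: Hr; rewrite {r}Er /= => Hr.
have := tape_config_next l q (c :: r'); move: Hr.
case: tm_delta => [[]|[[q' c'] m]] // Hr Es.
  apply: (accepts_next Es).2; eexists; [exact: rt_refl|by []].
by case: m Hr Es => Hr Es; apply: (accepts_next Es).2; exact: IHn.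
Qed.

(** Induction on the run of the two-stack machine, whose steps that only add a blank cell do not
    count as steps of M. *)
Lemma run_accepts l q r :
  accepts (tape_config l q r) ->
  exists n, tm_run n q (l, seq.head None r, behead r) = Some false.
Proof.
case=> d st; move Ec: (tape_config l q r) st => c st.
elim: {st}(clos_rt_rt1n _ _ _ _ st) l q r Ec => {c d} [c|c c' d cc' _ IH] l q r.
  by move=> <-.
move=> Ec Ed; move: cc'; rewrite /tnext -{}Ec tape_config_next.
case: r => [[/IH]|c1 r] /=; first by case=> // n Hn; exists n.
case Ed1: tm_delta => [[//|]|[[q' c2] m]].
  by exists 1; rewrite /= Ed1.
case: m Ed1 => Ed1 [/IH] => [] []// n Hn.
all: by exists n.+1; rewrite /= Ed1.
Qed.

Lemma duplicate w :
  steps (tnext delta)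
    ([:: LeftEnd], inr Read, map Raw w ++ [:: Sep; RightEnd])
    (tape_config [::] (tm_start M)
       [seq Some (inl b) | b <- pre ++ flatten [seq expand b | b <- w] ++ w]).
Proof.
(* The left stack once the bits [u] have been read and expanded. *)
pose left u : seq sym := rcons (map bit_cell (rev (flatten (map expand u)))) LeftEnd.
(* Each round moves one bit from before [Sep] to the end of the copy. *)
have loop u v : steps (tnext delta)
    (left u, inr Read, map Raw v ++ Sep :: rcons (map Raw u) RightEnd)
    (left (u ++ v), inr Read, Sep :: rcons (map Raw (u ++ v)) RightEnd).
  elim: v u => [|b v IHv] u; first by rewrite cats0; apply: rt_refl.
  rewrite -(cat_rcons b u v); apply: rt_trans (IHv (rcons u b)).
  have Eleft : left (rcons u b) = catrev (map bit_cell (expand b)) (left u).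
    rewrite /left map_rcons flatten_rcons rev_cat map_cat catrevE -map_rev.
    by rewrite rcons_cat.
  have [a [x Ex]] : exists a x, left u = a :: x.
    by rewrite /left headI; eexists; eexists.
  have [a' [x' Ex']] : exists a x, left (rcons u b) = a :: x.
    by rewrite /left headI; eexists; eexists.
  (* The letters crossed by the head with the carried bit, and again on its way back. *)
  pose z : seq sym := map Raw v ++ Sep :: map Raw u.
  apply: (@rt_trans _ _ _ (left (rcons u b), inr (Carry b), rcons z RightEnd)).
    by apply: rt_step; rewrite Eleft Ex /tnext /= rcons_cat.
  have zP c : c \in z -> (if c is (Raw _ | Sep) then true else false).
    by rewrite mem_cat inE => /or3P[/mapP[? _ ->]|/eqP->|/mapP[? _ ->]].
  apply: (@rt_trans _ _ _ (catrev z (left (rcons u b)), inr (Carry b), [:: RightEnd])).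
    rewrite Ex' -cats1 -{2}[z]map_id; apply: walk_right => d c /zP.
    by case: c.
  apply: (@rt_trans _ _ _ (catrev z (left (rcons u b)), inr Back, [:: Raw b; RightEnd])).
    rewrite Ex' catrevE; case: (rev z) => [|d y]; exact: rt_step.
  apply: (@rt_trans _ _ _ (left (rcons u b), inr Back, z ++ [:: Raw b; RightEnd])).
    rewrite [catrev z _]catrevE (_ : z ++ _ = catrev (rev z) [:: Raw b; RightEnd]); last first.
      by rewrite catrevE revK.
    apply: walk_left => c d.
    by rewrite mem_rev => /zP; case: c.
  (* At the end of the way back, the top of the left stack is neither [Raw] nor [Sep], so that
     [Back] gives way to [Read]. *)
  have : exists y, left (rcons u b) = LeftEnd :: y \/
      exists c, left (rcons u b) = bit_cell c :: y.
    rewrite /left; case: rev => [|c y]; first by exists [::]; left.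
    by eexists; right; exists c.
  have [c [y Ey]] : exists c y, z ++ [:: Raw b; RightEnd] = c :: y.
    by case: (z) => [|c y]; eexists; eexists.
  rewrite (_ : _ ++ Sep :: _ = z ++ [:: Raw b; RightEnd]); last first.
    by rewrite /z -catA map_rcons -!cats1 -!catA.
  by rewrite Ey => -[y' [->|[d ->]]]; apply: rt_step.
apply: rt_trans (loop [::] w) _; rewrite cat0s {loop}.
have [a [x Ex]] : exists a x, left w = a :: x.
  by rewrite /left headI; eexists; eexists.
apply: (@rt_trans _ _ _ (left w, inr Convert, rcons (map Raw w) RightEnd)).
  by apply: rt_step; rewrite Ex.
(* The effect of [Convert] on a letter, in the form that [walk_right] requires. *)
pose cv (a : sym) := if a is Raw c then bit_cell c else a.
apply: (@rt_trans _ _ _ (catrev (map cv (map Raw w)) (left w), inr Convert, [:: RightEnd])).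
  by rewrite Ex -cats1; apply: walk_right => d c /mapP[b _ ->].
rewrite -map_comp (eq_map (_ : cv \o Raw =1 bit_cell)) //.
set y := flatten _; have -> : catrev (map bit_cell w) (left w) =
    rcons (map bit_cell (rev (y ++ w))) LeftEnd.
  by rewrite /left catrevE -map_rev rev_cat map_cat rcons_cat.
apply: (@rt_trans _ _ _ (rcons (map bit_cell (rev (y ++ w))) LeftEnd, inr Rewind,
                         [:: RightEnd])).
  by apply: rt_step; case: (rev _).
rewrite -cats1.
apply: rt_trans (walk_left _ _ _ _) _; first by move=> d c /mapP[b _ ->].
rewrite catrevE -map_rev revK; apply: rt_step; rewrite /tnext.
have -> : map bit_cell (y ++ w) ++ [:: RightEnd] =
    seq.head RightEnd (map bit_cell (y ++ w)) ::
    behead (rcons (map bit_cell (y ++ w)) RightEnd).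
  by case: (y ++ w) => [|b z] //=; rewrite cats1.
rewrite /tape_config -!map_comp (eq_map (_ : @Cell _ \o _ =1 bit_cell)) //=.
congr (Some (_, _, _)); rewrite (map_cat _ pre) cat_rcons rcons_cat.
by case: (y ++ w).
Qed.

Theorem accepts_answers w :
  accepts ([:: LeftEnd], inr Read, map Raw w ++ [:: Sep; RightEnd]) <->
  tm_answers M (pre ++ flatten [seq expand b | b <- w] ++ w) false.
Proof.
have accN a b : delta (inr Accept) a b = None by [].
split=> [/(reaches_steps accN (duplicate w))/run_accepts //|[n Hn]].
by apply/(reaches_steps accN (duplicate w)); apply: accepts_run Hn.
Qed.

End Simulation.

(** * Length-preserving rewriting of binary words *)

(* Symbols are coded by blocks 1^i 0, where i = 0 is a space.  Spaces move
   freely, so that rules can be padded with them to preserve the length. *)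
Section Coding.
Variables (G : finType) (rules : seq (seq G * seq G)) (f : G).
Implicit Types (u v p l r s : seq (option G)) (U V : bits).

Definition block (a : option G) : bits :=
  enc_nat (if a is Some g then (enum_rank g).+1 else 0).

Definition code u : bits := flatten (map block u).

Definition spaces n : seq (option G) := nseq n None.

(** The number of spaces that make up for the code of [l], since a space is coded by one bit. *)
Definition weight (l : seq G) : nat := size (code (map Some l)).

Definition spaced_rules : seq (seq (option G) * seq (option G)) :=
  [seq (map Some lr.1 ++ spaces (weight lr.2),
        map Some lr.2 ++ spaces (weight lr.1)) | lr <- rules] ++
  [seq ([:: None; Some g], [:: Some g; None]) | g <- enum G] ++
  [seq ([:: Some g; None], [:: None; Some g]) | g <- enum G].

Definition bit_rules : seq (seq (bool * bool)) :=
  [seq zip (code lr.1) (code lr.2) | lr <- spaced_rules].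

(** By the default value [false], [p] is empty or ends with 0: the rule applies at the beginning of
    a block. *)
Definition bit_step U V : Prop :=
  exists (p : bits) z (s : bits), [/\ z \in bit_rules, last false p = false,
    U = p ++ unzip1 z ++ s & V = p ++ unzip2 z ++ s].

Definition bit_final U : Prop :=
  exists p s : bits, last false p = false /\ U = p ++ block (Some f) ++ s.

Lemma code_cat u v : code (u ++ v) = code u ++ code v.
Proof. by rewrite /code map_cat flatten_cat. Qed.

Lemma code_spaces n : code (spaces n) = nseq n false.
Proof. by elim: n => //= n; rewrite /code /= => ->. Qed.

Lemma block_free : prefix_free block.
Proof.
move=> [g|] [h|] s t /enc_nat_free [] //.
by move=> [/val_inj/enum_rank_inj->].
Qed.

Lemma code_prefix u v S : code u = code v ++ S ->
  exists2 s, u = v ++ s & S = code s.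
Proof.
elim: v u => [|a v IHv] [|b u] /=; do ?by exists [::].
- by move=> <-; exists (b :: u).
- by case: a.
rewrite -catA => /block_free[-> /IHv[s -> ->]]; by exists s.
Qed.

(** In a code, 0 only occurs at the end of a block, so every position after a 0 is a block
    boundary. *)
Lemma code_split u P S : code u = P ++ S -> last false P = false ->
  exists p s, [/\ u = p ++ s, P = code p & S = code s].
Proof.
elim: u P => [|a u IHu] P; first by case: P S => [|//] [|//]; exists [::], [::].
case: (posnP (size P)) => [/size0nil->|P0] /=.
  by move=> <- _; exists [::], (a :: u).
pose n := if a is Some g then (enum_rank g).+1 else 0.
have Ea : code (a :: u) = (nseq n true ++ [:: false]) ++ code u by [].
rewrite Ea => E lP.
(* [P] is nonempty; without the 0 that ends the first block it would consist of ones only. *)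
case: (leqP (size P) n) => [lePn|ltnP].
  have EP : P = nseq (size P) true.
    move: E => /(congr1 (take (size P))).
    rewrite (take_size_cat S (erefl _)) -catA takel_cat ?size_nseq // => EP.
    by rewrite -[LHS]EP take_nseq.
  have {lP}: last false (nseq (size P) true) = false by rewrite -EP.
  by case: (size P) P0 => // k _ /=; elim: k.
have EP : P = block a ++ drop n.+1 P.
  move: E => /(congr1 (take n.+1)); rewrite takel_cat; last first.
    by rewrite size_cat size_nseq addn1.
  rewrite take_oversize ?size_cat ?size_nseq ?addn1 // takel_cat // => Eb.
  by rewrite [block a]Eb cat_take_drop.
move: E lP; rewrite EP -[(block a ++ _) ++ S]catA => /block_free[_ /IHu {}IHu].
rewrite last_cat => lP; have /IHu[p [s [-> -> ->]]] : last false (drop n.+1 P) = false.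
  by case: (drop _ _) lP.
by exists (a :: p), s.
Qed.

Lemma last_code u : last false (code u) = false.
Proof.
elim/last_ind: u => // u a _; rewrite -cats1 code_cat /code /= cats0.
by rewrite /block /enc_nat !last_cat.
Qed.

Lemma size_spaced l r : (l, r) \in spaced_rules -> size (code l) = size (code r).
Proof.
rewrite !mem_cat => /or3P[] /mapP[x _ [-> ->]].
- by rewrite !code_cat !code_spaces !size_cat !size_nseq addnC.
- rewrite (code_cat [:: None] [:: Some x]) (code_cat [:: Some x] [:: None]).
  by rewrite !size_cat addnC.
- rewrite (code_cat [:: None] [:: Some x]) (code_cat [:: Some x] [:: None]).
  by rewrite !size_cat addnC.
Qed.

(** The rewritten factor lies between block boundaries: on the left by the condition on [p], on the
    right because blocks are prefix-free. *)
Lemma bit_step_code u V :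
  bit_step (code u) V <-> exists2 v, rewrites spaced_rules u v & V = code v.
Proof.
split=> [[P [z [S [/mapP[[l r] lr ->] lP]]]]|[v [p [l [r [s [lr -> ->]]]]] ->]].
  rewrite /= unzip1_zip ?unzip2_zip ?(size_spaced lr) // => E ->.
  have [p [u' [-> -> /esym/code_prefix[s -> ->]]]] := code_split E lP.
  by exists (p ++ r ++ s); rewrite ?code_cat //; exists p, l, r, s.
exists (code p), (zip (code l) (code r)), (code s); split.
- by apply/mapP; exists (l, r).
- exact: last_code.
- by rewrite unzip1_zip ?(size_spaced lr) // !code_cat.
- by rewrite unzip2_zip ?(size_spaced lr) // !code_cat.
Qed.

Lemma bit_final_code u : bit_final (code u) <-> Some f \in u.
Proof.
split=> [[P [S [lP E]]]|].
  have [p [s [-> _ E2]]] := code_split E lP.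
  have /code_prefix[t -> _] : code s = code [:: Some f] ++ S.
    by rewrite -E2 /code /= cats0.
  by rewrite mem_cat inE eqxx orbT.
case/splitPr=> p s; exists (code p), (code s).
rewrite code_cat; split=> //.
exact: last_code.
Qed.

Lemma bit_step_size U V : bit_step U V -> size U = size V.
Proof.
by move=> [p [z [s [_ _ -> ->]]]]; rewrite !size_cat !size_map.
Qed.

Lemma steps_bit u V :
  steps bit_step (code u) V <-> exists2 v, steps (rewrites spaced_rules) u v & V = code v.
Proof.
split=> [|[v st ->]].
  move EU: (code u) => U st.
  elim: {st}(clos_rt_rt1n _ _ _ _ st) u EU => {U V} [U|U V W UV _ IH] u EU.
    by exists u => //; apply: rt_refl.
  move: UV; rewrite -EU => /bit_step_code[v uv /esym/IH[w vw ->]].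
  by exists w => //; apply: rt_trans vw; apply: rt_step.
elim: st => {u v} [u v uv|u|u v w _ + _]; last exact: rt_trans.
  by apply/rt_step/bit_step_code; exists v.
exact: rt_refl.
Qed.

(** Erasing the spaces turns a padded rule into the original one, and the move of a space into no
    step at all. *)
Lemma erase_spaced u v :
  steps (rewrites spaced_rules) u v -> steps (rewrites rules) (pmap id u) (pmap id v).
Proof.
have pmapK (l : seq G) : pmap id (map Some l) = l by elim: l => //= a l ->.
have pmap0 n : pmap id (spaces n) = [::] by elim: n.
elim=> {u v} [u v [p [l [r [s [lr -> ->]]]]]|u|u v w _ + _]; last exact: rt_trans.
  move: lr; rewrite !mem_cat => /or3P[] /mapP[x]; rewrite ?mem_enum.
  - move=> xr [-> ->]; apply: rt_step; exists (pmap id p), x.1, x.2, (pmap id s).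
    by rewrite !pmap_cat !pmapK !pmap0 !cats0 -surjective_pairing.
  - by move=> _ [-> ->]; rewrite !pmap_cat; apply: rt_refl.
  - by move=> _ [-> ->]; rewrite !pmap_cat; apply: rt_refl.
exact: rt_refl.
Qed.

Lemma move_spaces n (u : seq G) :
  steps (rewrites spaced_rules) (map Some u ++ spaces n) (spaces n ++ map Some u) /\
  steps (rewrites spaced_rules) (spaces n ++ map Some u) (map Some u ++ spaces n).
Proof.
have memL g : ([:: None; Some g], [:: Some g; None]) \in spaced_rules.
  rewrite !mem_cat (map_f (fun g => ([:: None; Some g], [:: Some g; None]))).
    by rewrite orbT.
  by rewrite mem_enum.
have memR g : ([:: Some g; None], [:: None; Some g]) \in spaced_rules.
  rewrite !mem_cat (map_f (fun g => ([:: Some g; None], [:: None; Some g]))).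
    by rewrite !orbT.
  by rewrite mem_enum.
have move1 g : steps (rewrites spaced_rules) (Some g :: spaces n) (rcons (spaces n) (Some g)) /\
               steps (rewrites spaced_rules) (rcons (spaces n) (Some g)) (Some g :: spaces n).
  elim: n => [|n [IH1 IH2]]; first by split; apply: rt_refl.
  split.
    apply: (@rt_trans _ _ _ [:: None, Some g & spaces n]).
      by apply: rt_step; exists [::], [:: Some g; None], [:: None; Some g], (spaces n).
    exact: (rewrites_catl [:: None] IH1).
  apply: (@rt_trans _ _ _ [:: None, Some g & spaces n]).
    exact: (rewrites_catl [:: None] IH2).
  by apply: rt_step; exists [::], [:: None; Some g], [:: Some g; None], (spaces n).
elim: u => [|g u [IH1 IH2]]; first by rewrite /= cats0; split; apply: rt_refl.
rewrite -cat_rcons; split.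
  apply: rt_trans (rewrites_catl [:: Some g] IH1) _.
  exact: rewrites_catr (move1 g).1.
apply: (@rt_trans _ _ _ (Some g :: spaces n ++ map Some u)).
  exact: rewrites_catr (move1 g).2.
exact: rewrites_catl [:: Some g] _ _ IH2.
Qed.

(** Spaces wait at the end of the word. Those that a padded rule needs are brought to its left-hand
    side, and those that it leaves are sent back to the end. *)
Lemma spaced_steps (u v : seq G) :
  steps (rewrites rules) u v -> exists n m,
  steps (rewrites spaced_rules) (map Some u ++ spaces n) (map Some v ++ spaces m).
Proof.
move=> st; elim: {st}(clos_rt_rt1n _ _ _ _ st) => {u v} [u|].
  by exists 0, 0; apply: rt_refl.
move=> u v w [p [l [r [s [lr -> ->]]]]] _ [n [m IH]].
(* The first rule consumes [weight r] spaces and leaves [weight l] of them. *)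
exists (weight r + n), (m + weight l).
have dist (x : seq G) k n' : map Some (p ++ x ++ s) ++ spaces (k + n') =
    (map Some p ++ map Some x) ++ (map Some s ++ spaces k) ++ spaces n'.
  by rewrite /spaces nseqD !map_cat -!catA.
rewrite dist.
apply: rt_trans (rewrites_catl _ (rewrites_catr _ (move_spaces _ _).1)) _.
apply: (@rt_trans _ _ _ ((map Some p ++ map Some r) ++
    (spaces (weight l) ++ map Some s) ++ spaces n)).
  apply: rt_step; exists (map Some p), (map Some l ++ spaces (weight r)),
    (map Some r ++ spaces (weight l)), (map Some s ++ spaces n); split.
  - by rewrite mem_cat (map_f (fun lr => (map Some lr.1 ++ spaces (weight lr.2),
      map Some lr.2 ++ spaces (weight lr.1))) lr).
  - by rewrite -!catA.
  - by rewrite -!catA.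
apply: rt_trans (rewrites_catl _ (rewrites_catr _ (move_spaces _ _).2)) _.
rewrite -dist (addnC (weight l)) {dist}/spaces !nseqD 2!(catA (map _ _)).
exact: rewrites_catr.
Qed.

(** The successor in [n.+1] makes the word nonempty even if [u] is empty, and matches the nonempty
    prelude of [copy_vpa]. *)
Theorem bit_steps_rewrites (u : seq G) :
  (exists2 v, steps (rewrites rules) u v & f \in v) <->
  (exists n V, steps bit_step (code (map Some u) ++ nseq n.+1 false) V /\ bit_final V).
Proof.
split=> [[v /spaced_steps[n [m st]] fv]|[n [V []]]].
  (* The last space is the additional one, which no step touches. *)
  exists n, (code (map Some v ++ spaces m ++ spaces 1)); split.
    rewrite -code_spaces -code_cat; apply/steps_bit.
    exists (map Some v ++ spaces m ++ spaces 1) => //.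
    rewrite -(addn1 n) /spaces nseqD !catA; exact: rewrites_catr.
  apply/bit_final_code; rewrite mem_cat; apply/orP; left; exact: map_f.
rewrite -code_spaces -code_cat => /steps_bit[v st ->] /bit_final_code fv.
exists (pmap id v); last by rewrite mem_pmap map_id.
move: (erase_spaced st); rewrite pmap_cat.
have -> : pmap id (spaces n.+1) = [::] by elim: n {st}.
by rewrite cats0 (_ : pmap id (map Some u) = u) //; elim: u {st} => //= a u ->.
Qed.

End Coding.

(** * Visibly pushdown automata for sequences of mirrored blocks *)

(* The state also records the last letter read, so that only reduced words are
   accepted. *)
Section FinVpa.
Variables (X Q G : finType).
Variables (kind : letter X -> vpa_kind) (init final : pred Q).
Variables (dcall : Q -> letter X -> Q -> G -> bool).
Variables (dresp : Q -> letter X -> option G -> Q -> bool).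

Notation rstate := (Q * option (letter X))%type.

Definition fresh (o : option (letter X)) (a : letter X) : bool :=
  if o is Some b then a != linv b else true.

Definition rtrans (i : 'I_#|{: rstate}|) (a : letter X) (j : 'I_#|{: rstate}|)
    (d : Q -> Q -> bool) : bool :=
  let: (q, o) := enum_val i in let: (q', o') := enum_val j in
  [&& fresh o a, o' == Some a & d q q'].

Definition fin_vpa : vpa X := {|
  vpa_nstate := #|{: rstate}|;
  vpa_nstack := #|G|;
  vpa_part := [ffun a => kind a];
  vpa_init := enum [pred i | let: (q, o) := enum_val i in init q && (o == None)];
  vpa_final := enum [pred i | final (enum_val i).1];
  vpa_call := enum [pred t : 'I_#|{: rstate}| * letter X * 'I_#|{: rstate}| * 'I_#|G| |
    let: (i, a, j, c) := t in rtrans i a j (fun q q' => dcall q a q' (enum_val c))];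
  vpa_internal := [::];
  vpa_response := enum
    [pred t : 'I_#|{: rstate}| * letter X * option 'I_#|G| * 'I_#|{: rstate}| |
    let: (i, a, o, j) := t in
    rtrans i a j (fun q q' => dresp q a (omap enum_val o) q')] |}.

Fixpoint frun (q : Q) (s : seq G) (w : seq (letter X)) : Prop :=
  if w is a :: w' then
    match kind a with
    | Call => exists q' c, dcall q a q' c /\ frun q' (c :: s) w'
    | Internal => False
    | Response => exists q', dresp q a (ohead s) q' /\ frun q' (behead s) w'
    end
  else final q.

Definition reduced_from (o : option (letter X)) (w : seq (letter X)) : bool :=
  if o is Some b then path (fun a b => b != linv a) b w else reduced w.
Arguments reduced_from : simpl never.

Lemma reduced_from_cons o a w :
  reduced_from o (a :: w) = fresh o a && reduced_from (Some a) w.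
Proof. by case: o. Qed.

Lemma fin_vpa_run q o s w :
  @vpa_run X fin_vpa (enum_rank (q, o)) (map enum_rank s) w <->
  frun q s w /\ reduced_from o w.
Proof.
elim: w q o s => [|a w IHw] q o s /=.
  rewrite mem_enum inE enum_rankK /=; split=> [Fq|[]] //.
  by case: o.
rewrite reduced_from_cons; split.
  case=> j [s' []]; rewrite -[j]enum_valK; case Ej: (enum_val j) => [q' o'].
  rewrite /vpa_step /= ffunE; case: (kind a).
  - case=> c; rewrite mem_enum inE /rtrans !enum_rankK.
    move=> /and3P[-> /eqP-> dc] ->.
    rewrite -[c]enum_valK => /(IHw _ _ (_ :: _))[r ->]; split=> //.
    by exists q', (enum_val c).
  - by case; rewrite in_nil.
  - case; rewrite mem_enum inE /rtrans !enum_rankK => /and3P[-> /eqP-> dr] ->.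
    rewrite behead_map => /IHw[r ->]; split=> //; exists q'; split=> //.
    by case: (s) dr => //= c t; rewrite enum_rankK.
case=> Hr /andP[fa rw]; case Ek: (kind a) Hr => //.
  case=> q' [c [dc /(conj (B := reduced_from (Some a) w)) /(_ rw) /(IHw _ (Some a)) r]].
  exists (enum_rank (q', Some a)), (map enum_rank (c :: s)); split=> //.
  rewrite /vpa_step /= ffunE Ek; exists (enum_rank c) => //.
  by rewrite mem_enum inE /rtrans !enum_rankK fa eqxx.
case=> q' [dr r]; exists (enum_rank (q', Some a)), (map enum_rank (behead s)).
split; last exact/IHw.
rewrite /vpa_step /= ffunE Ek behead_map; split=> //.
rewrite mem_enum inE /rtrans !enum_rankK fa eqxx /=.
by case: (s) dr => //= c t; rewrite enum_rankK.
Qed.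

Lemma fin_vpa_accepts w :
  vpa_accepts fin_vpa w <-> reduced w /\ exists2 q, init q & frun q [::] w.
Proof.
split=> [[i]|[rw [q Iq r]]].
  rewrite mem_enum inE -[i]enum_valK; case: (enum_val i) => [q o].
  rewrite enum_rankK => /andP[Iq /eqP->] /(fin_vpa_run _ _ [::])[r rw].
  by split=> //; exists q.
exists (enum_rank (q, None)); first by rewrite mem_enum inE enum_rankK Iq eqxx.
by apply/(fin_vpa_run _ _ [::]).
Qed.

End FinVpa.

(* A nondeterministic letter-to-letter transducer maps each block of calls to a
   word O, and rev O has to be read as the following block of responses. The
   stack symbol (b, true) is the first one pushed by a block. With [prelude], the
   input starts with a nonempty word of zeros, read by responses on the empty
   stack. *)
Section BlockVpa.
Variables (X T : finType) (call resp : bool -> letter X).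
Hypotheses (call_inj : injective call) (resp_inj : injective resp).
Hypothesis call_resp : forall b c, call b != resp c.
Variables (tinit tfin tacc : pred T) (ttrans : T -> bool -> bool -> T -> bool).
Variable prelude : bool.

(** [Prelude] is inside the word of zeros, [InBlock t] inside a block of calls, [Popping] inside a
    block of responses; [Done] has just popped the symbol that opened the block. *)
Notation bstate := (T + option (option bool))%type.
Notation InBlock t := (inl t).
Notation Start := (inr None).
Notation Prelude := (inr (Some None)).
Notation Popping := (inr (Some (Some false))).
Notation Done := (inr (Some (Some true))).

Definition block_kind (a : letter X) : vpa_kind :=
  if a \in codom call then Call else if a \in codom resp then Response
  else Internal.

(** Whether [n] more prelude zeros may precede the blocks read from [q]; for [n = 0], whether a
    block of calls may begin at [q]. *)
Definition zeros_ok (q : bstate) (n : nat) : bool :=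
  match q with
  | Start => if prelude then 0 < n else n == 0
  | Prelude => prelude
  | Done => n == 0
  | _ => false
  end.

(** Entering a block already takes a transition from an initial state of the transducer, so that
    blocks are nonempty. *)
Definition block_call (q : bstate) (a : letter X) (q' : bstate)
    (c : bool * bool) : bool :=
  [exists b, (a == call b) &&
    match q, q' with
    | InBlock t, InBlock t' => ttrans t b c.1 t' && ~~ c.2
    | _, InBlock t' =>
        [&& zeros_ok q 0, c.2 & [exists t, tinit t && ttrans t b c.1 t']]
    | _, _ => false
    end].

Definition popped (first : bool) : bstate := if first then Done else Popping.

Definition block_resp (q : bstate) (a : letter X) (o : option (bool * bool))
    (q' : bstate) : bool :=
  [exists b, (a == resp b) &&
    match q, o with
    | (Start | Prelude), None => [&& prelude, ~~ b & q' == Prelude]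
    | InBlock t, Some (c, first) => [&& tfin t, c == b & q' == popped first]
    | Popping, Some (c, first) => (c == b) && (q' == popped first)
    | _, _ => false
    end].

Definition block_final (q : bstate) : bool :=
  match q with
  | InBlock t => tacc t
  | Prelude | Done => prelude
  | _ => false
  end.

Definition block_vpa : vpa X :=
  fin_vpa block_kind (pred1 Start) block_final block_call block_resp.

Fixpoint trun (P : pred T) (t : T) (U O : bits) : Prop :=
  match U, O with
  | [::], [::] => P t
  | b :: U', c :: O' => exists2 t', ttrans t b c t' & trun P t' U' O'
  | _, _ => False
  end.

Definition tblock (P : pred T) (U O : bits) : Prop :=
  exists2 t, tinit t & trun P t U O.

Inductive blocks : seq (letter X) -> Prop :=
| BlocksNil : prelude -> blocks [::]
| BlocksLast U O : U != [::] -> tblock tacc U O -> blocks (map call U)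
| BlocksCons U O w : U != [::] -> tblock tfin U O -> blocks w ->
    blocks (map call U ++ map resp (rev O) ++ w).

Notation run := (frun block_kind block_final block_call block_resp).

Lemma kind_call b : block_kind (call b) = Call.
Proof. by rewrite /block_kind codom_f. Qed.

Lemma kind_resp b : block_kind (resp b) = Response.
Proof.
rewrite /block_kind codom_f; case: codomP => // -[c] /eqP.
by rewrite eq_sym (negbTE (call_resp _ _)).
Qed.

Lemma run_cons q s a w : run q s (a :: w) ->
  (exists b q' c, [/\ a = call b, block_call q a q' c & run q' (c :: s) w]) \/
  (exists b q', [/\ a = resp b, block_resp q a (ohead s) q' & run q' (behead s) w]).
Proof.
rewrite /= {1}/block_kind; case: codomP => [[b ->] [q' [c [dc r]]]|_].
  by left; exists b, q', c.
by case: codomP => // -[b ->] [q' [dr r]]; right; exists b, q'.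
Qed.

Lemma block_callP q b q' c : block_call q (call b) q' c ->
  match q, q' with
  | InBlock t, InBlock t' => ttrans t b c.1 t' /\ c.2 = false
  | _, InBlock t' =>
      [/\ zeros_ok q 0, c.2 & exists2 t, tinit t & ttrans t b c.1 t']
  | _, _ => False
  end.
Proof.
case/existsP=> b' /andP[/eqP/call_inj <-].
case: q q' => [t|o] [t'|o'] //; first by case/andP=> -> /negbTE.
  by case/and3P=> -> -> /existsP[t /andP[it tt]]; split=> //; exists t.
Qed.

Lemma block_respP q b o q' : block_resp q (resp b) o q' ->
  match q, o with
  | (Start | Prelude), None => [/\ prelude, b = false & q' = Prelude]
  | InBlock t, Some (c, first) => [/\ tfin t, c = b & q' = popped first]
  | Popping, Some (c, first) => c = b /\ q' = popped first
  | _, _ => False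
  end.
Proof.
case/existsP=> b' /andP[/eqP/resp_inj <-].
case: q => [t|[[[]|]|]]; case: o => [[c fi]|] //.
- by case/and3P=> -> /eqP-> /eqP.
- by case/andP=> /eqP-> /eqP.
- by case/and3P=> -> /negbTE-> /eqP.
- by case/and3P=> -> /negbTE-> /eqP.
Qed.

(** The marked symbol delimits what the current block has pushed, and thus tells how many responses
    must follow. *)
Definition pops (s : seq (bool * bool)) (w : seq (letter X)) : Prop :=
  exists O c s' w', [/\ s = map (pair^~ false) O ++ (c, true) :: s',
    w = map resp (rcons O c) ++ w' & blocks w'].

(** The invariant of [run_block_lang]: the form of what remains to be read. *)
Definition block_lang (q : bstate) (s : seq (bool * bool))
    (w : seq (letter X)) : Prop :=
  match q with
  | InBlock t =>
      (exists U O, w = map call U /\ trun tacc t U O) \/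
      (exists U O w', [/\ w = map call U ++ w', trun tfin t U O &
                         pops (map (pair^~ false) (rev O) ++ s) w'])
  | Popping => pops s w
  | _ => exists n w', [/\ zeros_ok q n, w = nseq n (resp false) ++ w' & blocks w']
  end.

Lemma pops_cons (first : bool) b s w :
  block_lang (popped first) s w -> pops ((b, first) :: s) (resp b :: w).
Proof.
case: first => [[n [w' [/eqP -> -> bw']]]|[O [c [s' [w' [-> -> bw']]]]]].
  by exists [::], b, s, w'.
by exists (b :: O), c, s', w'.
Qed.

(** The first marked symbol of a stack splits it in a unique way. *)
Lemma pops_uniq O c s w :
  pops (map (pair^~ false) O ++ (c, true) :: s) w ->
  exists2 w', w = map resp (rcons O c) ++ w' & blocks w'.
Proof.
case=> O' [c' [s' [w' [E -> bw']]]]; exists w' => //.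
have [-> ->] // : O = O' /\ c = c'.
elim: O O' E => [|o O IHO] [|o' O'] //=; first by case=> ->.
by case=> -> /IHO[-> ->].
Qed.

Lemma run_block_lang q s w : run q s w -> block_lang q s w.
Proof.
elim: w q s => [|a w IHw] q s.
  case: q => [t|[[[]|]|]] //= Pq.
  - by left; exists [::], [::].
  - by exists 0, [::]; split=> //; apply: BlocksNil.
  - by exists 0, [::]; split=> //; apply: BlocksNil.
case/run_cons=> [[b [q' [c [-> /block_callP dc /IHw]]]]|
                 [b [q' [-> /block_respP dr /IHw]]]].
  case: q' dc => [t'|o]; last by case: q => // [[]].
  (* A call either continues the current block or opens a new one. *)
  wlog : / (exists2 t, q = inl t & ttrans t b c.1 t' /\ c.2 = false) \/
    exists o, [/\ q = inr o, zeros_ok q 0, c.2 & exists2 t, tinit t & ttrans t b c.1 t'].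
    move=> W dc; apply: (W _ dc).
    by case: (q) dc => [t dc|o dc]; [left; exists t | right; exists o; case: dc].
  case=> [[t -> [tr c2]] _ /= IH|[o [-> z0 c2 [t it tr]]] _ /= IH].
    case: IH => [[U [O [-> rU]]]|[U [O [w' [-> rU pw']]]]].
      by left; exists (b :: U), (c.1 :: O); split=> //; exists t'.
    right; exists (b :: U), (c.1 :: O), w'; split=> //; first by exists t'.
    by rewrite rev_cons map_rcons cat_rcons; case: (c) c2 pw' => ? ? /= ->.
  (* The new block pushes a marked symbol onto [s], so its responses stop there. *)
  suff bw : blocks (call b :: w).
    by move: z0; case: o => [[[]|]|] // z0; exists 0, (call b :: w).
  case: IH => [[U [O [-> rU]]]|[U [O [w' [-> rU]]]]].
    apply: (@BlocksLast (b :: U) (c.1 :: O)) => //.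
    by exists t => //; exists t'.
  rewrite [c]surjective_pairing c2 => /pops_uniq[w'' -> bw''].
  rewrite -rev_cons; apply: (@BlocksCons (b :: U) (c.1 :: O)) => //.
  by exists t => //; exists t'.
case: q dr => [t|[[[]|]|]] //; case: s => [|[c fi] s] //=.
- case=> tf -> -> /(pops_cons b) pw; right; exists [::], [::], (resp b :: w).
  by split.
- by case=> -> -> /(pops_cons b).
- case=> pr -> -> [n [w' [_ -> bw']]]; exists n.+1, w'; split=> //.
- case=> pr -> -> [n [w' [_ -> bw']]]; exists n.+1, w'; split=> //=.
  by rewrite pr.
Qed.

Lemma run_call b q s w q' c : block_call q (call b) q' c ->
  run q' (c :: s) w -> run q s (call b :: w).
Proof. by move=> dc r; rewrite /= kind_call; exists q', c. Qed.

Lemma run_resp b q s w q' : block_resp q (resp b) (ohead s) q' ->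
  run q' (behead s) w -> run q s (resp b :: w).
Proof. by move=> dr r; rewrite /= kind_resp; exists q'. Qed.

Lemma run_calls P t U O s w :
    trun P t U O ->
    (forall t', P t' -> run (InBlock t') (map (pair^~ false) (rev O) ++ s) w) ->
  run (InBlock t) s (map call U ++ w).
Proof.
elim: U O t s => [|b U IHU] [|c O] t s //; first by move=> Pt; apply.
case=> t' tr rU H; apply: (@run_call _ _ _ _ (InBlock t') (c, false)).
  by apply/existsP; exists b; rewrite eqxx /= tr.
apply: IHU rU _ => t'' /H; by rewrite rev_cons map_rcons cat_rcons.
Qed.

Lemma run_pops q O c s w :
    (if q is InBlock t then tfin t else q == Popping) -> run Done s w ->
  run q (map (pair^~ false) O ++ (c, true) :: s) (map resp (rcons O c) ++ w).
Proof.
move=> Hq Hr; elim: O q Hq => [|b O IHO] q Hq.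
  apply: (@run_resp _ _ _ _ Done) => //; apply/existsP; exists c; rewrite eqxx /=.
  by case: q Hq => [t /= ->|[[[]|]|]] //=; rewrite !eqxx.
apply: (@run_resp _ _ _ _ Popping); last exact: IHO.
apply/existsP; exists b; rewrite eqxx /=.
by case: q Hq => [t /= ->|[[[]|]|]] //=; rewrite !eqxx.
Qed.

Lemma blocks_run q s w : zeros_ok q 0 -> blocks w -> run q s w.
Proof.
(* Only the first call of a block pushes a marked symbol; the other calls are left to
   [run_calls]. *)
have enter q0 s0 b U c O t P t' w0 : zeros_ok q0 0 -> tinit t ->
    ttrans t b c t' -> trun P t' U O ->
    (forall t', P t' ->
      run (InBlock t') (map (pair^~ false) (rev O) ++ (c, true) :: s0) w0) ->
    run q0 s0 (map call (b :: U) ++ w0).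
  move=> z0 it tr rU H; apply: (@run_call _ _ _ _ (InBlock t') (c, true)).
    apply/existsP; exists b; rewrite eqxx /=; case: q0 z0 => // o ->.
    by case: o => [[[]|]|]; apply/existsP; exists t; rewrite it.
  exact: run_calls rU H.
move=> z0 bw; elim: bw q s z0 => {w} [pr|U O|U O w].
- by case=> // -[[[]|]|] //=; rewrite pr.
- case: U => // b U _ [t it]; case: O => // c O [t' tr rU] q s z0.
  by rewrite -[map _ _]cats0; apply: enter tr rU _.
case: U => // b U _ [t it]; case: O => // c O [t' tr rU] _ IH q s z0.
apply: enter tr rU _ => // t'' tf.
by rewrite rev_cons; apply: run_pops => //; apply: IH.
Qed.

Lemma block_vpa_accepts w :
  vpa_accepts block_vpa w <->
  reduced w /\ exists n w', [/\ if prelude then 0 < n else n == 0,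
    w = nseq n (resp false) ++ w' & blocks w'].
Proof.
split=> [/fin_vpa_accepts[rw [q /eqP-> /run_block_lang]]|[rw [n [w' [n0 Ew bw']]]]] //.
apply/fin_vpa_accepts; split=> //; exists Start; first exact/eqP.
case: n n0 Ew => [|n] n0 ->; first exact: blocks_run.
have pr : prelude by move: n0; case: prelude.
have toPrelude q : q \in [:: Start; Prelude] ->
    block_resp q (resp false) None Prelude.
  by rewrite !inE => /orP[]/eqP->; apply/existsP; exists false; rewrite !eqxx pr.
apply: (@run_resp _ _ [::] _ Prelude); first exact: toPrelude.
elim: n {n0} => [|n IHn]; first exact: blocks_run.
by apply: (@run_resp _ _ [::] _ Prelude); first exact: toPrelude.
Qed.

End BlockVpa.

(** * Rewriting sequences as an intersection of two languages *)

Section Chains.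
Variables (X G : finType) (rules : seq (seq G * seq G)) (f : G).
Variable x : bool -> X.
Hypothesis x_inj : injective x.

(** Finding the final symbol is treated as applying a rule that leaves its code unchanged, so that
    one transducer serves both purposes. *)
Definition final_rule : seq (bool * bool) := zip (block (Some f)) (block (Some f)).

(** The suffixes of the rules; they are finitely many, hence usable as states. *)
Definition rests : seq (seq (bool * bool)) :=
  [seq drop i z | z <- final_rule :: bit_rules rules, i <- iota 0 (size z).+1].

(* [None]: still copying; [Some (b, z)]: the pairs z of a rule remain to be
   read, where b marks the final rule. *)
Notation rule_state := (option (bool * seq_sub rests)).

Definition rule_start (q : rule_state) : bool :=
  if q is Some (b, z) then
    if b then ssval z == final_rule else ssval z \in bit_rules rules
  else true.

(** A rule starts after a copied 0, hence at the beginning of a block, unless it was chosen in the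
    initial state. Copying resumes once its pairs are exhausted. *)
Definition rule_trans (q : rule_state) (b c : bool) (q' : rule_state) : bool :=
  match q, q' with
  | None, None => b == c
  | None, Some _ => [&& b == c, ~~ b & rule_start q']
  | Some (d, z), Some (d', z') =>
      (d == d') && ((ssval z == (b, c) :: ssval z') ||
                    [&& ssval z == [::], ssval z' == [::] & b == c])
  | _, _ => false
  end.

Definition rule_done (d : bool) (q : rule_state) : bool :=
  if q is Some (b, z) then (b == d) && (ssval z == [::]) else false.

Lemma mem_rests z : z \in final_rule :: bit_rules rules -> z \in rests.
Proof.
by move=> zr; apply/allpairsPdep; exists z, 0; rewrite mem_iota drop0.
Qed.

Lemma rests_behead a z : a :: z \in rests -> z \in rests.
Proof.
case/allpairsPdep=> y [i [yr _ E]]; apply/allpairsPdep; exists y, i.+1; split=> //.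
  rewrite mem_iota /= add0n ltnS ltnNge; apply/negP=> le.
  by rewrite drop_oversize in E.
by rewrite -addn1 addnC -drop_drop -E /= drop0.
Qed.

Lemma trun_rest d d' z U O :
  trun rule_trans (rule_done d) (Some (d', z)) U O <->
  d' = d /\ exists s, U = unzip1 (ssval z) ++ s /\ O = unzip2 (ssval z) ++ s.
Proof.
elim: U O d' z => [|b U IHU] [|c O] d' z /=.
- split=> [/andP[/eqP-> /eqP->]|[-> [s [E _]]]]; first by split=> //; exists [::].
  by rewrite eqxx; case: (ssval z) E.
- split=> // -[_ [s []]]; case: (ssval z) => [|[? ?] ?] //= <- //.
- split=> // -[_ [s []]]; case: (ssval z) => [|[? ?] ?] //= <- //.
split.
  case=> [[[d1 z1]|] //] /andP[/eqP<- tr] /IHU[-> [s [-> ->]]]; split=> //.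
  case/orP: tr => [/eqP->|/and3P[/eqP-> /eqP-> /eqP->]]; first by exists s.
  by exists (c :: s).
case=> -> [s]; case Ez: (ssval z) => [|[b1 c1] z1] /= [].
  move=> Es Es'; rewrite -Es in Es'; case: Es' => Ec EO.
  exists (Some (d, z)); first by rewrite Ez !eqxx Ec /= eqxx.
  by apply/IHU; split=> //; exists U; rewrite Ez EO.
move=> [-> EU] [-> EO]; have z1r : z1 \in rests.
  by apply: (@rests_behead (b1, c1)); rewrite -Ez; apply: ssvalP.
exists (Some (d, SeqSub z1r)); first by rewrite /= !eqxx.
by apply/IHU; split=> //; exists s; rewrite EU EO.
Qed.

Definition fits (d : bool) (z : seq (bool * bool)) : bool :=
  if d then z == final_rule else z \in bit_rules rules.

Definition applies (d : bool) (U O : bits) : Prop :=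
  exists (p : bits) z (s : bits), [/\ fits d z, last false p = false,
    U = p ++ unzip1 z ++ s & O = p ++ unzip2 z ++ s].

(** Here the default value [true] makes [p] nonempty: a rule chosen while copying follows a copied
    0. *)
Lemma trun_copy d U O :
  trun rule_trans (rule_done d) None U O ->
  exists (p : bits) z (s : bits), [/\ fits d z, last true p = false,
    U = p ++ unzip1 z ++ s & O = p ++ unzip2 z ++ s].
Proof.
elim: U O => [|b U IHU] [|c O] //= [[[d' z]|]] /=.
  case/and3P=> /eqP-> /negbTE-> zs /trun_rest[Ed [s [-> ->]]].
  by exists [:: false], (ssval z), s; split=> //; rewrite -Ed.
move=> /eqP-> /IHU[p [z [s [fz lp -> ->]]]]; exists (c :: p), z, s; split=> //=.
by case: p lp {IHU}.
Qed.

Lemma tblock_rule d U O :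
  tblock rule_start rule_trans (rule_done d) U O <-> applies d U O.
Proof.
split=> [[[[d' z]|] st]|[p [z [s [fz lp -> ->]]]]].
- case/trun_rest=> Ed [s [-> ->]]; exists [::], (ssval z), s; split=> //.
  by rewrite -Ed.
- case/trun_copy=> p [z [s [fz lp -> ->]]]; exists p, z, s; split=> //.
  by case: p lp.
have zr : z \in rests.
  by apply: mem_rests; rewrite inE; case: d fz => /= ->; rewrite ?orbT.
have run0 : trun rule_trans (rule_done d) (Some (d, SeqSub zr))
    (unzip1 z ++ s) (unzip2 z ++ s).
  by apply/trun_rest; split=> //; exists s.
case: p lp => [|b p] /= lp; first by exists (Some (d, SeqSub zr)).
exists None => //; elim: p b lp => [|c p IHp] b lp /=.
  by move: lp => /= ->; exists (Some (d, SeqSub zr)).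
by exists None; [rewrite /= | apply: IHp].
Qed.

Lemma applies_final U : bit_final f U <-> exists O, applies true U O.
Proof.
have E1 : unzip1 final_rule = block (Some f) by rewrite unzip1_zip.
split=> [[p [s [lp ->]]]|[O [p [z [s [/eqP-> lp -> _]]]]]].
  by exists (p ++ unzip2 final_rule ++ s), p, final_rule, s; rewrite E1 /fits eqxx.
by exists p, s; rewrite E1.
Qed.

(** Letters of even and odd blocks. As [od b] is the inverse of [ev (~~ b)], only different bits
    cancel where blocks meet. *)
Definition ev (b : bool) : letter X := (x b, true).
Definition od (b : bool) : letter X := (x (~~ b), false).

Lemma ev_inj : injective ev. Proof. by move=> b c [/x_inj]. Qed.
Lemma od_inj : injective od. Proof. by move=> b c [/x_inj/negb_inj]. Qed.

Lemma ev_od b c : ev b != od c.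
Proof. by rewrite xpair_eqE andbF. Qed.

Definition step_vpa : vpa X :=
  block_vpa ev od rule_start (rule_done false) (rule_done true) rule_trans false.

(** The prelude reads the spaces appended to the initial word, and [pred0] forbids ending inside a
    block of calls. *)
Definition copy_vpa : vpa X :=
  block_vpa od ev (@predT unit) predT pred0 (fun _ b c _ => b == c) true.

Definition alt (bs : seq (bits * bits)) : seq (letter X) :=
  flatten [seq map od (rev VU.1) ++ map ev VU.2 | VU <- bs].

Definition nonempty (bs : seq (bits * bits)) : bool :=
  all (fun VU => (VU.1 != [::]) && (VU.2 != [::])) bs.

Fixpoint chain (U : bits) (bs : seq (bits * bits)) : Prop :=
  if bs is (V, U') :: bs' then bit_step rules U V /\ chain U' bs'
  else bit_final f U.

Lemma step_vpa_accepts w :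
  vpa_accepts step_vpa w <->
  reduced w /\ exists U bs, [/\ w = map ev U ++ alt bs, U != [::], nonempty bs &
                              chain U bs].
Proof.
apply: iff_trans (block_vpa_accepts ev_inj od_inj ev_od _ _ _ _ _ _) _.
split=> [[rw [n [w' [/eqP-> Ew bw]]]]|[rw [U [bs [Ew U0 bs0 ch]]]]]; split=> //.
  rewrite {rw}Ew /=.
  elim: bw => {w w'} [//|U O U0 /tblock_rule tU|U O w U0 /tblock_rule tU _].
    exists U, [::]; rewrite cats0; split=> //.
    by apply/applies_final; exists O.
  case=> [U' [bs [-> U'0 bs0 ch]]]; exists U, ((O, U') :: bs); split=> //=.
    by rewrite /alt /= -!catA.
  rewrite U'0 bs0 !andbT; apply: contraNneq U0 => O0.
  by rewrite -size_eq0 (bit_step_size tU) O0.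
exists 0, w; split=> //; rewrite Ew {w rw Ew}.
elim: bs U U0 bs0 ch => [|[V U'] bs IH] U U0 /=.
  move=> _ /applies_final[O tU]; rewrite cats0; apply: (BlocksLast _ _ _ _ U0).
  exact: (tblock_rule _ _ _).2 tU.
case/andP=> /andP[_ U'0] bs0 [tU ch]; rewrite /alt /= -!catA.
apply: (BlocksCons U0 ((tblock_rule false _ _).2 tU)).
exact: IH.
Qed.

Lemma copy_vpa_accepts w :
  vpa_accepts copy_vpa w <->
  reduced w /\ exists n vs, [/\ w = map ev (nseq n.+1 false) ++ alt [seq (v, v) | v <- vs]
    & all (fun v => v != [::]) vs].
Proof.
have copyE U O : tblock (@predT unit) (fun _ b c _ => b == c) predT U O <-> U = O.
  split=> [[[] _]|<-].
    by elim: U O => [|b U IHU] [|c O] //= [[]] /eqP-> /IHU->.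
  by exists tt => //; elim: U => // b U IHU /=; exists tt.
have lastN U O : ~ trun (fun _ b c _ => b == c) pred0 tt U O.
  by elim: U O => [|b U IHU] [|c O] //= [[] _ /IHU].
have od_ev b c : od b != ev c by rewrite eq_sym ev_od.
apply: iff_trans (block_vpa_accepts od_inj ev_inj od_ev _ _ _ _ _ _) _.
split=> [[rw [[|n] [w' [//= _ Ew bw]]]]|[rw [n [vs [Ew vs0]]]]]; split=> //.
  exists n; rewrite Ew map_nseq {rw Ew w}.
  suff [vs [-> vs0]] : exists vs, w' = alt [seq (v, v) | v <- vs] /\
      all (fun v => v != [::]) vs by exists vs.
  elim: bw => {w'} [_|U O _ [[] _ /lastN//]|U O w U0 /copyE <- _].
  - by exists [::].
  (* The calls read the mirror image of [v], so that [v] is [rev U]. *)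
  case=> vs [-> vs0]; exists (rev U :: vs); split=> /=.
    by rewrite /alt /= revK -!catA.
  by rewrite vs0 andbT; apply: contraNneq U0 => U0; rewrite -[U]revK U0.
exists n.+1, (alt [seq (v, v) | v <- vs]); rewrite Ew map_nseq; split=> //.
elim: vs vs0 {Ew rw} => [|v vs IH] /=; first by constructor.
case/andP=> v0 /IH bw; rewrite /alt /= -{2}[v]revK -!catA.
apply: (BlocksCons _ _ bw); last by apply/copyE.
by apply: contraNneq v0 => v0; rewrite -[v]revK v0.
Qed.

Lemma map_cat_uniq (g : bool -> letter X) (U V : bits) s t :
    injective g ->
    (forall b, ohead s <> Some (g b)) -> (forall b, ohead t <> Some (g b)) ->
  map g U ++ s = map g V ++ t -> U = V /\ s = t.
Proof.
move=> g_inj sN tN; elim: U V => [|b U IHU] [|c V] //=.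
- by move=> Es; case: (sN c); rewrite Es.
- by move=> Et; case: (tN b); rewrite -Et.
- by case=> /g_inj-> /IHU[-> ->].
Qed.

Lemma ohead_alt bs b : nonempty bs -> ohead (alt bs) <> Some (ev b).
Proof.
case: bs => [|[V U] bs] //; rewrite /alt /=.
by case/lastP: V => // V c; rewrite rev_rcons.
Qed.

(** The blocks are nonempty and alternate between disjoint alphabets, so they are the maximal
    factors over each alphabet. *)
Lemma alt_inj bs cs : nonempty bs -> nonempty cs -> alt bs = alt cs -> bs = cs.
Proof.
have evN (U : bits) s b : U != [::] -> ohead (map ev U ++ s) <> Some (od b).
  by case: U.
have altN (V U : bits) ds : V != [::] -> alt ((V, U) :: ds) <> [::].
  by case/lastP: V => // V c; rewrite /alt /= rev_rcons.
elim: bs cs => [|[V1 U1] bs IH] [|[V2 U2] cs] //=.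
- by move=> _ /andP[/andP[V0 _] _] /esym/altN; case.
- by move=> /andP[/andP[V0 _] _] _ /altN; case.
move=> /andP[/andP[V10 U10] bs0] /andP[/andP[V20 U20] cs0].
rewrite /alt /= -/(alt _) -/(alt _) -!catA.
case/(map_cat_uniq od_inj (fun b => evN _ _ b U10) (fun b => evN _ _ b U20)).
move=> /(can_inj revK)->.
case/(map_cat_uniq ev_inj (fun b => ohead_alt (b:=b) bs0)
                          (fun b => ohead_alt (b:=b) cs0)) => ->.
by move=> /IH->.
Qed.

(** Inside a block all signs agree. Where blocks meet the bits are equal: two final zeros before a
    mirror image, then twice the first bit of [v] between its mirror image and itself. *)
Lemma reduced_chain U vs : last false U = false ->
  all (fun v => last true v == false) vs ->
  reduced (map ev U ++ alt [seq (v, v) | v <- vs]).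
Proof.
set e := fun a b : letter X => b != linv a.
have pathE b V : path e (ev b) (map ev V).
  by elim: V b => //= c V IHV b; rewrite IHV /e /linv xpair_eqE andbF.
have pathO b V : path e (od b) (map od V).
  by elim: V b => //= c V IHV b; rewrite IHV /e /linv xpair_eqE andbF.
move=> lU vs0; suff P : path e (ev false) (alt [seq (v, v) | v <- vs]).
  case: U lU => [_|b U /= lU] /=; first by apply: path_sorted P.
  by rewrite cat_path pathE last_map lU.
elim: vs vs0 {U lU} => //= v vs IH /andP[/eqP lv /IH{}IH].
case/lastP: v lv => // v c; rewrite last_rcons => ->.
have ev_alt b V : last b V = false ->
    path e (od b) (map ev (b :: V) ++ alt [seq (v, v) | v <- vs]).
  move=> lV; rewrite /= cat_path pathE last_map lV IH !andbT.
  by rewrite /e /linv xpair_eqE andbT; case: (b); apply/eqP=> /x_inj.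
rewrite /alt /= -/(alt _) rev_rcons /= -catA cat_path pathO last_map; apply/andP; split.
  by rewrite /e /linv xpair_eqE andbT; apply/eqP=> /x_inj.
case: v => [|b v]; first exact: (ev_alt false [::]).
by rewrite rev_cons last_rcons; apply: ev_alt; rewrite last_rcons.
Qed.

(** All the words of the derivation are codes with the length of [U], so they are nonempty and end
    with 0. *)
Lemma steps_chain U V : steps (bit_step rules) U V -> bit_final f V ->
    last true U = false -> (exists u : seq (option G), U = code u) ->
  exists2 vs, chain U [seq (v, v) | v <- vs] & all (fun v => last true v == false) vs.
Proof.
move=> st fV; elim: {st}(clos_rt_rt1n _ _ _ _ st) fV => {U V} [U fU|U V W UV _ IH fW].
  by exists [::].
move=> lU [u Eu]; move: (UV); rewrite Eu => /bit_step_code[v _ EV].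
have lV : last true V = false.
  have := last_code v; rewrite -EV; move: (bit_step_size UV) lU.
  by case: (V) => //; case: (U).
have [|vs ch vs0] := IH fW lV; first by exists v.
by exists (V :: vs); rewrite /= ?lV -?Eu.
Qed.

Lemma chain_steps U vs : chain U [seq (v, v) | v <- vs] ->
  exists2 V, steps (bit_step rules) U V & bit_final f V.
Proof.
elim: vs U => [|v vs IH] U /=; first by exists U => //; apply: rt_refl.
case=> Uv /IH[V vV fV]; exists V => //; apply: rt_trans vV; exact: rt_step.
Qed.

(** Both automata describe the blocks of [y]; comparing the two descriptions by [alt_inj] shows that
    each word obtained by a step is the next word of the sequence. *)
Theorem chains_rewrites (u : seq G) :
  (exists y z, [/\ vpa_accepts step_vpa y, vpa_accepts copy_vpa z &
                 y = map ev (code (map Some u)) ++ z]) <->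
  (exists2 v, steps (rewrites rules) u v & f \in v).
Proof.
have diag0 (vs : seq bits) : nonempty [seq (v, v) | v <- vs] = all (fun v => v != [::]) vs.
  by rewrite /nonempty all_map; apply: eq_all => v /=; rewrite andbb.
split=> [[y [z [/step_vpa_accepts[_ [U [bs [-> U0 bs0 ch]]]]]]]|].
  case/copy_vpa_accepts=> _ [n [vs [-> vs0]]]; rewrite catA -map_cat.
  rewrite -diag0 in vs0.
  case/(map_cat_uniq ev_inj (fun b => ohead_alt (b:=b) bs0)
                            (fun b => ohead_alt (b:=b) vs0)).
  move=> EU /(alt_inj bs0 vs0) Ebs; rewrite Ebs in ch; have [V st fV] := chain_steps ch.
  by apply/bit_steps_rewrites; exists n, V; rewrite -EU.
case/bit_steps_rewrites=> n [V [st fV]].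
have EU : code (map Some u) ++ nseq n.+1 false = code (map Some u ++ spaces G n.+1).
  by rewrite code_cat code_spaces.
have lU c : last c (code (map Some u) ++ nseq n.+1 false) = false.
  by rewrite last_cat /=; elim: (n).
have [|vs ch lvs] := steps_chain st fV (lU _); first by eexists; exact: EU.
have vs0 : all (fun v => v != [::]) vs.
  by apply: sub_all lvs => -[|b v].
exists (map ev (code (map Some u) ++ nseq n.+1 false) ++ alt [seq (v, v) | v <- vs]).
exists (map ev (nseq n.+1 false) ++ alt [seq (v, v) | v <- vs]); split.
- apply/step_vpa_accepts; split; first exact: reduced_chain.
  by eexists; eexists; split; [by [] | rewrite -size_eq0 size_cat addnS | rewrite diag0 |].
- apply/copy_vpa_accepts; split; last by exists n, vs.
  by apply: reduced_chain => //=; elim: (n).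
- by rewrite map_cat catA.
Qed.

End Chains.

(** * Pushdown automata for preimages in the word monoid *)

Section FinPda.
Variables (X Q G : finType) (bottom : G) (init final : pred Q).

(* [None] pops the top of the stack, [Some None] leaves it, [Some (Some d)]
   pushes d. *)
Notation action := (option (option G)).
Variable trans : Q -> option (letter X) -> G -> Q -> action -> bool.

Definition replacement (c : G) (k : action) : seq G :=
  match k with None => [::] | Some None => [:: c] | Some (Some d) => [:: d; c] end.

Definition fin_pda : pda X := {|
  pda_nstate := #|Q|;
  pda_nstack := #|G|;
  pda_bottom := enum_rank bottom;
  pda_init := map enum_rank (enum init);
  pda_final := map enum_rank (enum final);
  pda_trans := [seq let: (q, o, c, q', k) := t in
      (enum_rank q, o, enum_rank c, enum_rank q', map enum_rank (replacement c k)) |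
    t : Q * option (letter X) * G * Q * action <-
      enum [pred t | let: (q, o, c, q', k) := t in trans q o c q' k]] |}.

Inductive prun : Q -> seq G -> seq (letter X) -> Prop :=
| PrunStop q s : final q -> prun q s [::]
| PrunStep q o c q' k s w :
    trans q o c q' k -> prun q' (replacement c k ++ s) w ->
    prun q (c :: s) (if o is Some a then a :: w else w).

Lemma fin_pda_run q s w :
  @pda_run X fin_pda (enum_rank q) (map enum_rank s) w <-> prun q s w.
Proof.
split=> [r|].
  suff: prun (enum_val (enum_rank q)) (map enum_val (map enum_rank s)) w.
    by rewrite enum_rankK mapK //; apply: enum_rankK.
  elim: r => {q s w} [i s /mapP[q]|i o c j t s w].
    by rewrite mem_enum => Fq ->; rewrite enum_rankK; apply: PrunStop.
  case/mapP=> -[[[[q o'] c'] q'] k]; rewrite mem_enum => tr [-> -> -> -> ->] _ /=.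
  rewrite !enum_rankK map_cat mapK; last exact: enum_rankK.
  exact: PrunStep.
elim=> {q s w} [q s Fq|q o c q' k s w tr _ r].
  by apply: PdaStop; apply/map_f; rewrite mem_enum.
rewrite map_cat in r; apply: PdaStep r; apply/mapP; exists (q, o, c, q', k) => //.
by rewrite mem_enum.
Qed.

Lemma fin_pda_accepts w :
  pda_accepts fin_pda w <-> exists2 q, init q & prun q [:: bottom] w.
Proof.
split=> [[i /mapP[q]]|[q Iq r]].
  rewrite mem_enum => Iq -> /(fin_pda_run _ [:: bottom]) r; by exists q.
exists (enum_rank q); first by apply/map_f; rewrite mem_enum.
exact/(fin_pda_run _ [:: bottom]).
Qed.

End FinPda.

Section Projection.
Local Open Scope group_scope.
Variable X : choiceType.

Lemma fg_proj_cons (a : letter X) w :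
  fg_proj (a :: w) = fg_letter a * fg_proj w.
Proof. by rewrite /fg_proj big_cons. Qed.

Lemma fg_proj_cat (u v : seq (letter X)) :
  fg_proj (u ++ v) = fg_proj u * fg_proj v.
Proof. by rewrite /fg_proj big_cat. Qed.

Lemma fg_proj_word (g : free_group X) : fg_proj (fg_word g) = g.
Proof. by apply: val_inj; rewrite /= fg_projE reduce_id // (valP g). Qed.

End Projection.

(* The automaton simulates A on the free reduction of its input.  The stack of A
   lies under the list of the letters still expected in order to complete the
   trivial factors being read. *)
Section GroupPda.
Local Open Scope group_scope.
Variables (X : finType) (A : vpa X).

(** An epsilon-transition enters the final state [None] after checking that no letter is expected,
    which acceptance by state alone cannot test. On the stack, [None] is the bottom and [inl a] an
    expected letter. *)
Notation gstate := (option 'I_(vpa_nstate A)).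
Notation gstack := (option (letter X + 'I_(vpa_nstack A))).

Definition expected (c : gstack) : bool := if c is Some (inl _) then true else false.

Definition vpa_move (q : 'I_(vpa_nstate A)) (a : letter X) (c : gstack)
    (q' : 'I_(vpa_nstate A)) (k : option (option gstack)) : bool :=
  match vpa_part A a, k with
  | Call, Some (Some (Some (inr d))) =>
      ~~ expected c && ((q, a, q', d) \in vpa_call A)
  | Internal, Some None => ~~ expected c && ((q, a, q') \in vpa_internal A)
  | Response, None =>
      if c is Some (inr d) then (q, a, Some d, q') \in vpa_response A else false
  | Response, Some None =>
      if c is None then (q, a, None, q') \in vpa_response A else false
  | _, _ => false
  end.

(** A letter is guessed to open a trivial factor, to be an expected one, or to belong to the reduced
    word read by [A]. *)
Definition group_move (q : gstate) (o : option (letter X)) (c : gstack)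
    (q' : gstate) (k : option (option gstack)) : bool :=
  match q, o, q' with
  | Some q, Some a, Some q' =>
      [|| (q == q') && (k == Some (Some (Some (inl (linv a))))),
          [&& q == q', c == Some (inl a) & k == None] | vpa_move q a c q' k]
  | Some q, None, None => [&& q \in vpa_final A, ~~ expected c & k == Some None]
  | _, _, _ => false
  end.

Definition group_pda : pda X :=
  fin_pda None [pred q | if q is Some q' then q' \in vpa_init A else false]
    (pred1 None) group_move.

Notation run := (prun (pred1 None) group_move).

Definition stack (e : seq (letter X)) (s : seq 'I_(vpa_nstack A)) : seq gstack :=
  map (fun a => Some (inl a)) e ++ rcons (map (fun c => Some (inr c)) s) None.

Lemma stack_top s : exists c t, stack [::] s = c :: t /\ ~~ expected c.
Proof. by case: s => [|c s]; eexists; eexists. Qed.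

Lemma run_None s w : run None s w -> w = [::].
Proof. by move Eq: None => q r; case: r Eq => // q0 o c q' k s0 w0 + _ Eq; rewrite -Eq. Qed.

Lemma stack_step q a e s c t q' k :
    vpa_move q a c q' k -> stack e s = c :: t ->
  e = [::] /\ exists s', vpa_step q s a q' s' /\
                         replacement c k ++ t = stack [::] s'.
Proof.
rewrite /vpa_move /vpa_step; case: e => [|b e] /=; last first.
  move=> + [Ec _]; rewrite -Ec /=.
  by case: (vpa_part A a); case: k => [[[[?|?]|]|]|].
move=> mv Es; split=> //; move: mv Es; rewrite /stack /=.
case: (vpa_part A a); case: k => [[[[?|d]|]|]|] //.
- by case/andP=> _ cA Es; exists (d :: s); rewrite /= Es; split=> //; exists d.
- by case/andP=> _ iA Es; exists s; rewrite Es.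
- by case: c => // rA; case: s => [|d s] // [<-]; exists [::].
- by case: c => [[|d]|] // rA; case: s => [|d' s] //= [Ed <-]; exists s; rewrite Ed.
Qed.

(** Opening a trivial factor with [a] adds [linv a] to [e], and the two cancel in the group; the
    other moves read the first letter of [e] or of [v]. *)
Lemma group_pda_sound q e s w : run (Some q) (stack e s) w ->
  exists2 v, vpa_run q s v & fg_proj w = fg_proj e * fg_proj v.
Proof.
move Eq: (Some q) => q0; move Et: (stack e s) => t r.
elim: r q e s Eq Et => {q0 t w} [_ t /eqP-> //|q0 o c q1 k t w mv r IH] q e s Eq Et.
rewrite -{}Eq in mv; case: o q1 mv r IH => [a|] [q1|] //= mv r IH.
  case/or3P: mv => [/andP[/eqP Eq /eqP Ek]|/and3P[/eqP Eq /eqP Ec /eqP Ek]|mv].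
  - have [|v rv Ew] := IH q1 (linv a :: e) s erefl; first by rewrite Ek /= -Et.
    exists v; first by rewrite Eq.
    by rewrite fg_proj_cons Ew fg_proj_cons fg_letterV !mulgA mulgV mul1g.
  - move: Et; rewrite Ec; case: e => [|b e] /=; first by case: (s).
    case=> -> Et; have [|v rv Ew] := IH q1 e s erefl; first by rewrite Ek.
    exists v; first by rewrite Eq.
    by rewrite !fg_proj_cons Ew mulgA.
  - have [-> [s' [st Es']]] := stack_step mv Et.
    have [|v rv Ew] := IH q1 [::] s' erefl; first by rewrite Es'.
    exists (a :: v); first by exists q1, s'.
    by rewrite !fg_proj_cons Ew /fg_proj big_nil !mul1g.
case/and3P: mv => Fq ec _; rewrite (run_None r); exists [::] => //.
case: e Et => [|b e] /=; first by rewrite /fg_proj !big_nil mulg1.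
by case=> Ec; rewrite -Ec in ec.
Qed.

Lemma group_pda_complete q e s v w :
  vpa_run q s v -> reduce w = e ++ v -> run (Some q) (stack e s) w.
Proof.
elim: w q e s v => [|a w IHw] q e s v rv Ew.
  case: e v Ew rv => [|//] [|//] _ Fq.
  have [c [t [-> ec]]] := stack_top s.
  apply: (@PrunStep _ _ _ _ _ _ None c None (Some None) t [::]).
    by rewrite /= Fq ec.
  exact: PrunStop.
(* Here [a] cancels with the first letter of [reduce w], which becomes expected. *)
have run_push : reduce w = linv a :: e ++ v -> run (Some q) (stack e s) (a :: w).
  move=> Ew'.
  have [c [t Ec]] : exists c t, stack e s = c :: t.
    by case: (e) (s) => [|b e'] [|d s']; eexists; eexists.
  rewrite Ec; apply: (@PrunStep _ _ _ _ _ _ (Some a) c (Some q)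
    (Some (Some (Some (inl (linv a))))) t).
    by rewrite /= !eqxx.
  rewrite [_ ++ _]/= -Ec; exact: (IHw q (linv a :: e) s v).
(* Here [a] survives: it is the expected letter on top, or the next letter of [v] if [e] is
   empty. *)
have run_next : a :: reduce w = e ++ v -> run (Some q) (stack e s) (a :: w).
  case: e {Ew run_push} => [|b e] /=.
    case: v rv => [//|b v] /= [q' [s' [st rv]]] [Ea Ew]; rewrite -Ea in st.
    have {}IH := IHw q' [::] s' v rv Ew.
    move: st; rewrite /vpa_step; case Ep: (vpa_part A a).
    - case=> d dA Es'; have [c [t [Ec ec]]] := stack_top s; rewrite Ec.
      apply: (@PrunStep _ _ _ _ _ _ (Some a) c (Some q')
        (Some (Some (Some (inr d)))) t); first by rewrite /= /vpa_move Ep ec dA !orbT.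
      by rewrite /= -Ec; rewrite Es' in IH.
    - case=> iA Es'; have [c [t [Ec ec]]] := stack_top s; rewrite Ec.
      apply: (@PrunStep _ _ _ _ _ _ (Some a) c (Some q') (Some None) t).
        by rewrite /= /vpa_move Ep ec iA !orbT.
      by rewrite /= -Ec -Es'.
    - case: s {rv} => [|d s] /= [rA Es']; rewrite Es' in IH.
        apply: (@PrunStep _ _ _ _ _ _ (Some a) None (Some q') (Some None) [::]) => //.
        by rewrite /= /vpa_move Ep rA !orbT.
      apply: (@PrunStep _ _ _ _ _ _ (Some a) (Some (inr d)) (Some q') None) => //.
      by rewrite /= /vpa_move Ep rA !orbT.
  case=> <- Ew; apply: (@PrunStep _ _ _ _ _ _ (Some a) (Some (inl a)) (Some q) None).
    by rewrite /= !eqxx !orbT.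
  exact: IHw rv Ew.
move: Ew; rewrite /reduce /= -/(reduce w) /cons_red.
case Er: (reduce w) => [|b u]; first by rewrite -Er => /run_next.
case: eqP => [Eb|_]; last by rewrite -Er => /run_next.
by move=> Eu; apply: run_push; rewrite Er Eb Eu.
Qed.

Theorem cf_forall_group_pda R : vpl_red A R -> cf_forall group_pda R.
Proof.
case=> red_A R_A w; split.
  case/fin_pda_accepts=> -[q Iq|//] /(@group_pda_sound q [::] [::])[v rv Ew].
  apply/R_A; exists v; first by exists q.
  by rewrite Ew /fg_proj big_nil mul1g.
case/R_A=> v Av Ev; have rv := red_A v Av; case: Av => q Iq rq.
apply/fin_pda_accepts; exists (Some q) => //.
apply: (@group_pda_complete q [::] [::] v) => //.
by rewrite -fg_projE -Ev fg_projE reduce_id.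
Qed.

End GroupPda.

(** * The self-referential equation *)

Section Evaluation.
Local Open Scope group_scope.
Variables (X Y : choiceType) (h : Y -> free_group X).

Definition eval_letter (a : letter Y) : free_group X :=
  if a.2 then h a.1 else (h a.1)^-1.

(** The homomorphism extending [h], from the universal property of the free group. *)
Definition eval (g : free_group Y) : free_group X :=
  \prod_(a <- fg_word g) eval_letter a.

Lemma eval_letterV a : eval_letter (linv a) = (eval_letter a)^-1.
Proof. by case: a => y []; rewrite /eval_letter //= invgK. Qed.

Lemma eval_reduce w :
  \prod_(a <- reduce w) eval_letter a = \prod_(a <- w) eval_letter a.
Proof.
elim: w => //= a w IHw; rewrite /reduce /= -/(reduce w) big_cons -{}IHw.
case: (reduce w) => [|b u] /=; first by rewrite big_cons.
case: eqP => [->|_]; last by rewrite !big_cons.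
by rewrite big_cons eval_letterV mulgA mulgV mul1g.
Qed.

Lemma evalM : {morph eval : g k / g * k}.
Proof. by move=> g k; rewrite /eval /= eval_reduce big_cat. Qed.

HB.instance Definition _ := isMultiplicative.Build _ _ eval evalM.

Lemma eval_gen y : eval (fg_gen y) = h y.
Proof. by rewrite /eval big_cons big_nil mulg1. Qed.

End Evaluation.

Section PrefixEquation.
Local Open Scope group_scope.
Variables (X : finType) (C : Type) (presents : C -> (free_group X -> Prop) -> Prop).

Definition const_letter n (a : letter X) : letter (X + 'I_n) := (inl a.1, a.2).

(** The equation Y = w Z, with [c1] constraining Y and [c2] constraining Z. *)
Definition prefix_eqn (w : seq (letter X)) (c1 c2 : C) : equation X C :=
  @Equation X C 2 [:: (inr ord0, true)]
    (map (@const_letter 2) w ++ [:: (inr ord_max, true)]) [tuple c1; c2].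

Lemma morph_const n (sigma : {multiplicative free_group (X + 'I_n)%type -> free_group X}) w :
  (forall a, sigma (fg_gen (inl a)) = fg_gen a) ->
  sigma (fg_proj (map (@const_letter n) w)) = fg_proj w.
Proof.
have s1 : sigma 1 = 1 by apply: (mulgI (sigma 1)); rewrite -gmulfM !mulg1.
have sV g : sigma g^-1 = (sigma g)^-1.
  by apply: (mulgI (sigma g)); rewrite -gmulfM !mulgV s1.
move=> s_id; elim: w => [|[a b] w IHw]; first by rewrite /fg_proj !big_nil s1.
rewrite /= !fg_proj_cons gmulfM IHw; congr (_ * _).
case: b; first exact: s_id.
rewrite -[LHS]/(sigma (fg_letter (linv (inl a, true)))) fg_letterV sV s_id.
by rewrite -fg_letterV.
Qed.

Lemma solvable_prefix w c1 c2 :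
  solvable presents (prefix_eqn w c1 c2) <->
  exists R1 R2 g k, [/\ presents c1 R1, presents c2 R2, R1 g, R2 k &
                       g = fg_proj w * k].
Proof.
have single n (v : X + 'I_n) : fg_proj [:: (v, true)] = fg_gen v.
  by rewrite /fg_proj big_cons big_nil mulg1.
split=> [[R pR [sigma [s_id Es] Rs]]|[R1 [R2 [g [k [p1 p2 Rg Rk Eg]]]]]].
  exists (R ord0), (R ord_max), (sigma (fg_gen (inr ord0))), (sigma (fg_gen (inr ord_max))).
  split=> //; [exact: (pR ord0) | exact: (pR ord_max) |].
  by move: Es; rewrite /= fg_proj_cat gmulfM morph_const // !single.
pose R (i : 'I_2) := if i == ord0 then R1 else R2.
pose h (v : X + 'I_2) := match v with
  | inl a => fg_gen a | inr i => if i == ord0 then g else k end.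
exists R.
  by case=> [[|[|//]] lt2]; [apply: p1 | apply: p2].
exists (eval h : {multiplicative _ -> _}).
  split=> [a|]; first exact: eval_gen.
  rewrite /= fg_proj_cat gmulfM morph_const => [|a]; last exact: eval_gen.
  rewrite !single; apply: etrans (eval_gen h _) _; rewrite [LHS]Eg; congr (_ * _).
  exact: esym (eval_gen h (inr ord_max)).
move=> i; suff: R i (h (inr i)) by rewrite -(eval_gen h (inr i)).
by case: i => [[|[|//]] lt2]; [apply: Rg | apply: Rk].
Qed.

End PrefixEquation.

Definition vpa_set (X : finType) (A : vpa X) (g : free_group X) : Prop :=
  exists2 w, vpa_accepts A w & fg_proj w = g.

Definition only_reduced (X : finType) (A : vpa X) : Prop :=
  forall w, vpa_accepts A w -> reduced w.

(** Allows one diagonal argument to serve both kinds of constraints. *)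
Definition describes_vpl (X : finType) (C : Type)
    (presents : C -> (free_group X -> Prop) -> Prop) (describe : vpa X -> C) : Prop :=
  forall A, only_reduced A -> presents (describe A) (vpa_set A) /\
    forall R, presents (describe A) R -> forall g, R g <-> vpa_set A g.

Lemma tm_run_add (M : tm) n m q t b :
  tm_run n q t = Some b -> @tm_run M (n + m) q t = Some b.
Proof.
elim: n q t => //= n IHn q [[l c] r].
by case: tm_delta => // [[[q' c'] mv]]; apply: IHn.
Qed.

Lemma tm_answers_uniq (M : tm) w b c :
  tm_answers M w b -> tm_answers M w c -> b = c.
Proof.
move=> [n Hn] [m Hm]; apply: Some_inj.
by rewrite -(tm_run_add m Hn) addnC (tm_run_add n Hm).
Qed.

Section Diagonal.
Variables (X : finType) (C : Type) (enc : C -> bits).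
Variables (presents : C -> (free_group X -> Prop) -> Prop) (describe : vpa X -> C).
Variable x : bool -> X.
Hypotheses (x_inj : injective x) (describe_vpl : describes_vpl presents describe).

Lemma reduced_ev_cat (U : bits) b t :
  reduced (ev x b :: t) -> reduced (map (ev x) U ++ ev x b :: t).
Proof.
move=> Rt; elim: U => [//|c U]; case: U => [_|d U] /=.
  by rewrite {1}/linv xpair_eqE andbF.
by move=> ->; rewrite {1}/linv xpair_eqE andbF.
Qed.

(** Reduced words are determined by their group elements, so the equation in the group becomes an
    equality of words as in [chains_rewrites]. *)
Lemma solvable_rewrites (G : finType) (rules : seq (seq G * seq G)) f (u : seq G) :
  solvable presents (prefix_eqn (map (ev x) (code (map Some u)))
    (describe (step_vpa rules f x)) (describe (copy_vpa x))) <->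
  exists2 v, steps (rewrites rules) u v & f \in v.
Proof.
have redS : only_reduced (step_vpa rules f x).
  by move=> w /(step_vpa_accepts _ _ x_inj)[].
have redK : only_reduced (copy_vpa x) by move=> w /(copy_vpa_accepts x_inj)[].
have [pS uS] := describe_vpl redS; have [pK uK] := describe_vpl redK.
apply: iff_trans (solvable_prefix _ _ _ _) _.
apply: iff_trans (chains_rewrites rules f x_inj u).
split=> [[R1 [R2 [g [k [p1 p2 R1g R2k Eg]]]]]|].
  have [y Sy Ey] := (uS _ p1 g).1 R1g; have [z Kz Ez] := (uK _ p2 k).1 R2k.
  exists y, z; split=> //; rewrite -(reduce_id (redS y Sy)).
  rewrite -fg_projE Ey Eg -Ez -fg_proj_cat fg_projE reduce_id //.
  (* [z] begins with a positive letter, a zero of the prelude, so no cancellation occurs when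
     positive letters are put before it. *)
  have := redK z Kz; case/(copy_vpa_accepts x_inj): Kz => _ [n [vs [-> _]]].
  exact: reduced_ev_cat.
case=> y [z [Sy Kz Ey]]; exists (vpa_set (step_vpa rules f x)), (vpa_set (copy_vpa x)).
exists (fg_proj y), (fg_proj z); split=> //; [by exists y|by exists z|].
by rewrite Ey fg_proj_cat.
Qed.

Theorem undecidable_of_describes :
  ~ tm_decidable (enc_equation enc) (valid_instance presents) (solvable presents).
Proof.
case=> M decM.
pose G : finType := (symbol (tm_aux M) + (tm_state M + phase))%type.
pose enc_bits (s : bits) : bits :=
  flatten [seq true :: @enc_eq_letter X 2 (const_letter 2 (ev x b)) | b <- s].
pose bcode (u : seq G) : bits := code (map Some u).
have enc_bits_cat s t : enc_bits (s ++ t) = enc_bits s ++ enc_bits t.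
  by rewrite /enc_bits map_cat flatten_cat.
(* The encoding up to the place where the code of [w] begins inside the right-hand side. *)
pose pre := enc_nat 2 ++ enc_seq (@enc_eq_letter X 2) [:: (inr ord0, true)] ++
  enc_bits (bcode [:: inl LeftEnd; inr (inr Read)]).
(* The contribution of one bit of [w] to the encoding of the right-hand side. *)
pose expand b := enc_bits (bcode [:: inl (Raw b)]).
(* Neither the rules nor the constraints below mention [w], which makes the self-reference
   possible. *)
pose rules := trules (delta (M := M) pre expand).
pose c1 := describe (step_vpa rules (inr (inr Accept)) x).
pose c2 := describe (copy_vpa x).
(* The rest of the encoding: the end of the configuration, the variable Z, the end of the right-hand
   side and the constraints. *)
pose w := enc_bits (bcode [:: inl Sep; inl RightEnd]) ++
  (true :: @enc_eq_letter X 2 (inr ord_max, true)) ++ [:: false] ++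
  enc_seq enc [tuple c1; c2].
pose u : seq G := config_word
  ([:: LeftEnd], inr Read, map Raw w ++ [:: Sep; RightEnd]).
pose E := prefix_eqn (map (ev x) (bcode u)) c1 c2.
(* The expansions of the bits of [w] encode its occurrence in [u], and [w] itself is the end of the
   encoding. *)
have encE : enc_equation enc E = pre ++ flatten [seq expand b | b <- w] ++ w.
  have -> : flatten [seq expand b | b <- w] =
      enc_bits (bcode (map inl (map Raw w))).
    elim: (w) => // b v IHv.
    transitivity (expand b ++ enc_bits (bcode (map inl (map Raw v)))).
      by rewrite -IHv.
    by rewrite -enc_bits_cat -code_cat.
  have Erhs s : enc_seq (@enc_eq_letter X 2)
      (map (@const_letter X 2) (map (ev x) s) ++ [:: (inr ord_max, true)]) =
    enc_bits s ++ (true :: @enc_eq_letter X 2 (inr ord_max, true)) ++ [:: false].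
    rewrite /enc_seq map_cat flatten_cat -!map_comp -catA.
    by congr (_ ++ (_ ++ _)); apply: cats0.
  have Eu : enc_bits (bcode u) = enc_bits (bcode [:: inl LeftEnd; inr (inr Read)]) ++
      enc_bits (bcode (map inl (map Raw w))) ++ enc_bits (bcode [:: inl Sep; inl RightEnd]).
    rewrite -!enc_bits_cat /bcode -!code_cat -!map_cat; congr (enc_bits (code (map _ _))).
    by rewrite /u /= map_cat.
  rewrite -[LHS]/(enc_nat 2 ++ enc_seq (@enc_eq_letter X 2) [:: (inr ord0, true)] ++
    enc_seq (@enc_eq_letter X 2)
      (map (@const_letter X 2) (map (ev x) (bcode u)) ++ [:: (inr ord_max, true)]) ++
    enc_seq enc [tuple c1; c2]).
  have catE (a b c d e y z t : bits) : a ++ b ++ ((c ++ d ++ e) ++ y ++ z) ++ t =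
      (a ++ b ++ c) ++ d ++ e ++ y ++ z ++ t by rewrite -!catA.
  rewrite Erhs Eu; exact: catE.
have yesE : solvable presents E <-> tm_answers M (enc_equation enc E) false.
  rewrite encE; apply: iff_trans (solvable_rewrites _ _ _) _.
  apply: iff_trans (accepts_answers _ _ _ _).
  by apply: iff_sym; apply: reaches_config.
have validE : valid_instance presents E.
  exists (fun i => if i == ord0 then vpa_set (step_vpa rules (inr (inr Accept)) x)
                   else vpa_set (copy_vpa x)).
  case=> [[|[|//]] lt2].
    by apply: (describe_vpl _).1 => z /(step_vpa_accepts _ _ x_inj)[].
  by apply: (describe_vpl _).1 => z /(copy_vpa_accepts x_inj)[].
have [yes_true no_false] := decM E validE.
have no : ~ solvable presents E.
  by move=> yes; have := tm_answers_uniq (yes_true yes) (yesE.1 yes).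
exact/no/yesE/no_false.
Qed.

End Diagonal.

Lemma vpl_red_describes (X : finType) : describes_vpl (@vpl_red X) id.
Proof.
by move=> A rA; split=> [|R [_ RA] //]; split.
Qed.

(** Every group element is the projection of its own word, so the language of the pushdown automaton
    determines the set. *)
Lemma cf_forall_describes (X : finType) :
  describes_vpl (@cf_forall X) (@group_pda X).
Proof.
move=> A rA; have pA : cf_forall (group_pda A) (vpa_set A).
  by apply: cf_forall_group_pda; split.
split=> // R pR g; rewrite -[g]fg_proj_word.
exact: iff_trans (iff_sym (pR _)) (pA _).
Qed.

Theorem proposition11 (X : finType) (hX : 1 < #|X|) :
  ~ tm_decidable (enc_equation (@enc_vpa X))
      (valid_instance (@vpl_red X)) (solvable (@vpl_red X)) /\
  ~ tm_decidable (enc_equation (@enc_pda X))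
      (valid_instance (@cf_forall X)) (solvable (@cf_forall X)).
Proof.
pose x (b : bool) : X := enum_val (if b then Ordinal hX else Ordinal (ltnW hX)).
have x_inj : injective x by case=> [] [] //= /enum_val_inj.
split.
  exact: undecidable_of_describes x_inj (@vpl_red_describes X).
exact: undecidable_of_describes x_inj (@cf_forall_describes X).
Qed.
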